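(* Let $A$ and $B$ be C$^*$-algebras and let $S:A\to B$ be a triple homomorphism. The following statements are equivalent: 1) $S$ is a TRO homomorphism; 2) $S$ preserves TRO-zero products, that is, $S(a)S(b)^*S(c)=0$ whenever $a,b,c\in A$ satisfy $ab^*c=0$; 3) $S(a)S(b)^*=0$ whenever $a,b\in A$ satisfy $ab^*=0$.
   Context: A linear map $S:A\to B$ between C$^*$-algebras is a triple homomorphism if $S(\{a,b,c\})=\{S(a),S(b),S(c)\}$ for all $a,b,c\in A$, where $\{a,b,c\}=\frac12(ab^*c+cb^*a)$; it is a TRO homomorphism if $S(ab^*c)=S(a)S(b)^*S(c)$ for all $a,b,c\in A$. *)

(* Defs.v *)
(* MathComp-Analysis; complex scalars are R[i] from mathcomp real-closed. *)
From HB Require Import structures.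
From mathcomp Require Import all_boot all_order all_algebra.
From mathcomp Require Import complex.
From mathcomp Require Import all_classical all_reals all_analysis.

Set Implicit Arguments.
Unset Strict Implicit.
Unset Printing Implicit Defensive.

Import Order.TTheory GRing.Theory Num.Theory.
Import numFieldNormedType.Exports.

Local Open Scope ring_scope.
Local Open Scope complex_scope.

(* C*-algebras are not assumed to be unital, hence not MathComp rings, so the
   product is part of the structure.  The norm of a normedModType R[i] takes
   its values in R[i]; they are nonnegative, hence real. *)
HB.mixin Record CompleteNormedModule_isCStarAlgebra (R : realType) A
    of CompleteNormedModule R[i] A := {
  cstar_mul : A -> A -> A ;
  cstar_adj : A -> A ;
  cstar_mulA : forall a b c : A,
    cstar_mul a (cstar_mul b c) = cstar_mul (cstar_mul a b) c ;
  cstar_mulDl : forall a b c : A,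
    cstar_mul (a + b) c = cstar_mul a c + cstar_mul b c ;
  cstar_mulDr : forall a b c : A,
    cstar_mul a (b + c) = cstar_mul a b + cstar_mul a c ;
  cstar_mulZl : forall (k : R[i]) (a b : A),
    cstar_mul (k *: a) b = k *: cstar_mul a b ;
  cstar_mulZr : forall (k : R[i]) (a b : A),
    cstar_mul a (k *: b) = k *: cstar_mul a b ;
  cstar_adjK : forall a : A, cstar_adj (cstar_adj a) = a ;
  cstar_adjD : forall a b : A,
    cstar_adj (a + b) = cstar_adj a + cstar_adj b ;
  cstar_adjZ : forall (k : R[i]) (a : A),
    cstar_adj (k *: a) = Num.conj k *: cstar_adj a ;
  cstar_adjM : forall a b : A,
    cstar_adj (cstar_mul a b) = cstar_mul (cstar_adj b) (cstar_adj a) ;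
  cstar_normM : forall a b : A, `|cstar_mul a b| <= `|a| * `|b| ;
  cstar_norm_adj_mul : forall a : A,
    `|cstar_mul (cstar_adj a) a| = `|a| ^+ 2
}.

#[short(type="cstarAlgType")]
HB.structure Definition CStarAlgebra (R : realType) :=
  {A of CompleteNormedModule R[i] A
      & CompleteNormedModule_isCStarAlgebra R A}.

Declare Scope cstar_scope.
Delimit Scope cstar_scope with cstar.
Notation "a ** b" := (cstar_mul a b)
  (at level 40, left associativity) : cstar_scope.
Notation "a ^star" := (cstar_adj a)
  (at level 1, format "a ^star") : cstar_scope.
Local Open Scope cstar_scope.

Section TripleHomomorphisms.
Variable R : realType.

Definition triple_product (A : cstarAlgType R) (a b c : A) : A :=
  2^-1 *: (a ** b^star ** c + c ** b^star ** a).

Variables A B : cstarAlgType R.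

Definition triple_homomorphism (S : {linear A -> B}) : Prop :=
  forall a b c : A,
    S (triple_product a b c) = triple_product (S a) (S b) (S c).

Definition tro_homomorphism (S : {linear A -> B}) : Prop :=
  forall a b c : A, S (a ** b^star ** c) = S a ** (S b)^star ** S c.

Definition preserves_tro_zero_products (S : {linear A -> B}) : Prop :=
  forall a b c : A, a ** b^star ** c = 0 -> S a ** (S b)^star ** S c = 0.

End TripleHomomorphisms.

(* Main.v *)
Require Import Defs.
From HB Require Import structures.
From mathcomp Require Import all_boot all_order all_algebra.
From mathcomp Require Import complex all_classical all_reals all_analysis.
From mathcomp Require Import ring lra zify.

(** The implications from 1) to 2) and from 2) to 3) are short algebra with the
    C*-identity; all the work is in the passage from 3) to 1).

    The bridge is the balance identity
    S(a f) S(b)^star = S(a) S(b f^star)^star for all a, b, f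
    ([zero_products_balanced]).  Once it is known, the rest is algebra
    ([balanced_tro]).  The defect D(a,b,c) = S(a b^star c) - S(a) S(b)^star S(c)
    is alternating in a and c because S preserves the triple product, and the
    balance identity gives D(a,b,c) S(d)^star = S(a) D(d,c,b)^star.  In this
    four-variable expression a right factor can be moved freely from one
    argument to another, so it does not see the order of factors; together with
    the alternation this makes it vanish on products, hence everywhere.
    Vanishing is transferred from x x^star x to x by the C*-identity
    ([cube_cancel]), which replaces both factorization theorems and
    approximate units.

    The balance identity only has to be proved for a self-adjoint f = x of norm
    at most 1.  If h and k are functions with h k = 0, then a h(x) and b k(x)
    form a zero product, so S(a h(x)) S(b k(x))^star = 0.  Replacing x by
    (1 + x) / 2 moves its spectrum to [0, 1].  Cover this interval by N + 1 tents
    d_0, ..., d_N, spaced by 1 / N and forming a partition of unity.  The identity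
    function is the sum of the tents weighted by i / N, so the two sides of the
    balance identity differ by
    (1/N) sum_(i,j) (i - j) S(a d_i(x)) S(b d_j(x))^star.
    Only |i - j| <= 1 contributes.  Collecting the tents modulo 3 rewrites that
    sum as six terms S(a D_r(x)) S(b D_s(x))^star, where the D_r are sums of
    tents and still have sup norm at most 1.  As S is contractive, the
    difference is at most 6 |a| |b| / N, for every N ([balance_estimate]).

    This uses two pieces of analysis, both obtained from one elementary order
    theory.  Real polynomials in x act on the algebra by right multiplication,
    and the operator norm nu of this action satisfies the commutative C*-inequality
    nu(p)^2 <= nu(p^2 + q^2) ([bnd_sq]).  Call a polynomial positive if it is a
    norm limit of squares.  Iterating q |-> (t + q^2) / 2 produces approximate
    square roots of 1 - t whenever nu(t) <= 1, and from this the positive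
    polynomials are closed under sums and products, and two-sided bounds
    -M <= p <= M yield nu(p) <= M ([pos_abs_bnd]).

    - Functional calculus for Lipschitz functions ([fcalc]): h(x) is the limit
      of the Bernstein polynomials of h.  Convergence, the sup-norm bound and
      the fact that h k = 0 gives orthogonal operators all follow from
      Chebyshev's variance argument, carried out in the ordered polynomial ring
      ([bern2_bnd]).

    - Contractivity of S ([triple_contractive]).  If |a| < 1 = |S a|, the
      geometric series solves w = a + Q^4 w with Q v = a v^star a.  Then
      m = S(a)^star S(w) and h = S(a)^star S(a) satisfy m = h + h^2 m h^2 with
      |h| = 1, which is impossible because |h^k - h^(k+2)| tends to 0 while
      |h^k| = 1 ([no_resolvent]). *)

Set Implicit Arguments.
Unset Strict Implicit.
Unset Printing Implicit Defensive.

Import Order.TTheory GRing.Theory Num.Theory.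
Import numFieldNormedType.Exports.

Local Open Scope ring_scope.
Local Open Scope complex_scope.
Local Open Scope classical_set_scope.
Local Open Scope cstar_scope.

(** * Elementary algebra and real-valued norm in a C*-algebra *)

Section CStarBasics.
Variables (R : realType) (A : cstarAlgType R).
Implicit Types a b c x y : A.

Lemma cmul0l a : (0 : A) ** a = 0.
Proof. by apply: (@addrI _ (0 ** a)); rewrite -cstar_mulDl !addr0. Qed.

Lemma cmul0r a : a ** (0 : A) = 0.
Proof. by apply: (@addrI _ (a ** 0)); rewrite -cstar_mulDr !addr0. Qed.

Lemma cmulNl a b : (- a) ** b = - (a ** b).
Proof. by apply: (@addrI _ (a ** b)); rewrite -cstar_mulDl !subrr cmul0l. Qed.

Lemma cmulNr a b : a ** (- b) = - (a ** b).
Proof. by apply: (@addrI _ (a ** b)); rewrite -cstar_mulDr !subrr cmul0r. Qed.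

Lemma cmulBl a b c : (a - b) ** c = a ** c - b ** c.
Proof. by rewrite cstar_mulDl cmulNl. Qed.

Lemma cmulBr a b c : a ** (b - c) = a ** b - a ** c.
Proof. by rewrite cstar_mulDr cmulNr. Qed.

Lemma cadj0 : (0 : A)^star = 0.
Proof. by apply: (@addrI _ (0^star)); rewrite -cstar_adjD !addr0. Qed.

Lemma cadjN a : (- a)^star = - a^star.
Proof. by apply: (@addrI _ (a^star)); rewrite -cstar_adjD !subrr cadj0. Qed.

Lemma cadjB a b : (a - b)^star = a^star - b^star.
Proof. by rewrite cstar_adjD cadjN. Qed.

Lemma cmul_sumr (I : Type) (r : seq I) (P : pred I) (F : I -> A) a :
  a ** (\sum_(i <- r | P i) F i) = \sum_(i <- r | P i) a ** F i.
Proof.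
by elim/big_rec2: _ => [|i y1 y2 _ <-]; rewrite ?cmul0r // cstar_mulDr.
Qed.

Lemma cmul_suml (I : Type) (r : seq I) (P : pred I) (F : I -> A) a :
  (\sum_(i <- r | P i) F i) ** a = \sum_(i <- r | P i) F i ** a.
Proof.
by elim/big_rec2: _ => [|i y1 y2 _ <-]; rewrite ?cmul0l // cstar_mulDl.
Qed.

Lemma cadj_sum (I : Type) (r : seq I) (P : pred I) (F : I -> A) :
  (\sum_(i <- r | P i) F i)^star = \sum_(i <- r | P i) (F i)^star.
Proof.
by elim/big_rec2: _ => [|i y1 y2 _ <-]; rewrite ?cadj0 // cstar_adjD.
Qed.

(** The norm of the algebra takes its values in R[i]; its real part carries
    the whole information and lives where linear arithmetic is available. *)
Definition rnorm a : R := complex.Re `|a|.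

Lemma rnormE a : `|a| = (rnorm a)%:C.
Proof. by rewrite /rnorm RRe_real // normr_real. Qed.

Lemma rnorm_ge0 a : 0 <= rnorm a.
Proof. by rewrite -lecR -rnormE normr_ge0. Qed.

Lemma rnorm0 : rnorm (0 : A) = 0.
Proof. by rewrite /rnorm normr0. Qed.

Lemma rnorm_eq0 a : rnorm a = 0 -> a = 0.
Proof. by move=> h; apply/eqP; rewrite -normr_eq0 rnormE h. Qed.

Lemma rnormN a : rnorm (- a) = rnorm a.
Proof. by rewrite /rnorm normrN. Qed.

Lemma rnormD a b : rnorm (a + b) <= rnorm a + rnorm b.
Proof. by rewrite -lecR rmorphD /= -!rnormE ler_normD. Qed.

Lemma rnormB a b : rnorm (a - b) <= rnorm a + rnorm b.
Proof. by rewrite -(rnormN b) rnormD. Qed.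

Lemma rnormBC a b : rnorm (a - b) = rnorm (b - a).
Proof. by rewrite -rnormN opprB. Qed.

Lemma rnormM a b : rnorm (a ** b) <= rnorm a * rnorm b.
Proof. by rewrite -lecR rmorphM /= -!rnormE cstar_normM. Qed.

Lemma rnormZ (k : R[i]) a : rnorm (k *: a) = complex.Re `|k| * rnorm a.
Proof.
apply: complexI; rewrite rmorphM -!rnormE normrZ; congr (_ * _).
exact: esym (RRe_real (normr_real _)).
Qed.

Lemma rnormZr (k : R) a : rnorm (k%:C *: a) = `|k| * rnorm a.
Proof. by rewrite rnormZ normc_def /= expr0n /= addr0 sqrtr_sqr. Qed.

Lemma rnorm_adjM a : rnorm (a^star ** a) = rnorm a ^+ 2.
Proof.
by apply: complexI; rewrite rmorphXn /= -!rnormE cstar_norm_adj_mul.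
Qed.

Lemma rnorm_adj a : rnorm (a^star) = rnorm a.
Proof.
suff H b : rnorm b <= rnorm b^star.
  by apply/eqP; rewrite eq_le H -{2}(cstar_adjK a) H.
have := rnormM b^star b; rewrite rnorm_adjM expr2.
have [->|b0] := eqVneq (rnorm b) 0; first by rewrite rnorm_ge0.
by rewrite ler_pM2r // lt0r b0 rnorm_ge0.
Qed.

Lemma rnorm_mul_adj a : rnorm (a ** a^star) = rnorm a ^+ 2.
Proof. by rewrite -{1}(cstar_adjK a) rnorm_adjM rnorm_adj. Qed.

Lemma mul_adj_eq0 a : a ** a^star = 0 -> a = 0.
Proof.
move=> h; apply: rnorm_eq0; apply/eqP; rewrite -sqrf_eq0.
by rewrite -rnorm_mul_adj h rnorm0.
Qed.

Lemma adj_mul_eq0 a : a^star ** a = 0 -> a = 0.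
Proof.
move=> h; apply: rnorm_eq0; apply/eqP; rewrite -sqrf_eq0.
by rewrite -rnorm_adjM h rnorm0.
Qed.

End CStarBasics.

(** * A balanced triple homomorphism is a TRO homomorphism *)

Section BalancedTriple.
Variables (R : realType) (A B : cstarAlgType R) (S : {linear A -> B}).
Hypothesis hS : triple_homomorphism S.
Hypothesis bal : forall a b f : A,
  S (a ** f) ** (S b)^star = S a ** (S (b ** f^star))^star.

(** The triple identity cleared of its factor 1/2. *)
Lemma tripleE a b c :
  S (a ** b^star ** c) + S (c ** b^star ** a) =
  S a ** (S b)^star ** S c + S c ** (S b)^star ** S a.
Proof.
have n2 : (2 : R[i]) != 0 by rewrite pnatr_eq0.
have := hS a b c; rewrite /triple_product linearZ /= linearD /=.
by move/(congr1 (fun x => 2 *: x)); rewrite !scalerA divff // !scale1r.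
Qed.

Lemma doubleI (V : lmodType R[i]) (u : V) : u + u = 0 -> u = 0.
Proof.
move=> h; have n2 : (2 : R[i]) != 0 by rewrite pnatr_eq0.
have : (2 : R[i]) *: u = 0 by rewrite scaler_nat mulr2n.
by move/eqP; rewrite scaler_eq0 (negPf n2) /= => /eqP.
Qed.

Lemma double_inj (V : lmodType R[i]) (u v : V) : u + u = v + v -> u = v.
Proof.
move=> h; apply/subr0_eq/(@doubleI V).
by rewrite addrACA -opprD h subrr.
Qed.

Lemma tripleQ a b : S (a ** b^star ** a) = S a ** (S b)^star ** S a.
Proof. exact: double_inj (tripleE a b a). Qed.

Definition tro_defect a b c := S (a ** b^star ** c) - S a ** (S b)^star ** S c.
Local Notation D := tro_defect.

Lemma tro_defect_alt a b c : D c b a = - D a b c.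
Proof.
rewrite /tro_defect opprB; apply: subr0_eq; rewrite opprB addrACA.
by rewrite -opprD [X in _ - X]addrC -tripleE addrC subrr.
Qed.

(** Only the factor b^star c of the first term of the defect is moved by the
    balance identity; the other term is a matter of associativity. *)
Lemma tro_defect_shift a b c d : D a b c ** (S d)^star = S a ** (D d c b)^star.
Proof.
rewrite /tro_defect cmulBl cadjB cmulBr -(cstar_mulA a) bal; congr (_ - _).
  by rewrite cstar_adjM cstar_adjK cstar_mulA.
by rewrite !cstar_adjM !cstar_adjK !cstar_mulA.
Qed.

Let E a b c d := D a b c ** (S d)^star.

Lemma defect4_alt a b c d : E a b c d = - E c b a d.
Proof. by rewrite /E tro_defect_alt cmulNl. Qed.

Lemma defect4_cd a b c d f : E a b (c ** f) d = E a b c (d ** f^star).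
Proof.
rewrite /E /tro_defect !cmulBl; congr (_ - _); first by rewrite cstar_mulA bal.
by rewrite -(cstar_mulA _ (S (c ** f))) bal cstar_mulA.
Qed.

Lemma defect4_ab a b c d f : E (a ** f) b c d = E a (b ** f^star) c d.
Proof.
rewrite /E !tro_defect_shift /tro_defect !cadjB !cmulBr; congr (_ - _).
  by rewrite bal cstar_mulA.
by rewrite !cstar_adjM !cstar_adjK !cstar_mulA bal.
Qed.

Lemma defect4_ac a b c d f : E (a ** f) b c d = E a b (c ** f) d.
Proof. by rewrite defect4_alt defect4_cd -defect4_alt defect4_cd. Qed.

(** Two right factors of the first argument are interchanged by sending them
    to different arguments and bringing them back in the other order. *)
Lemma defect4_comm a f g b c d : E (a ** f ** g) b c d = E (a ** g ** f) b c d.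
Proof. by rewrite defect4_ab defect4_ac -defect4_ab -defect4_ac. Qed.

(** With G^star S(x)^star S(x) on the left, the hypothesis is the C*-square of
    S(x)^star S(x) G; a second use of the C*-identity removes the remaining
    S(x)^star.  This lets x be tested on x x^star x, which is a product. *)
Lemma cube_cancel x (G : B) : S (x ** x^star ** x) ** G = 0 -> S x ** G = 0.
Proof.
rewrite tripleQ => h.
have h1 : (S x)^star ** S x ** G = 0.
  apply: adj_mul_eq0; rewrite !cstar_adjM cstar_adjK.
  have -> : G^star ** ((S x)^star ** S x) ** ((S x)^star ** S x ** G) =
            G^star ** (S x)^star ** (S x ** (S x)^star ** S x ** G).
    by rewrite !cstar_mulA.
  by rewrite h cmul0r.
apply: adj_mul_eq0; rewrite cstar_adjM.
have -> : G^star ** (S x)^star ** (S x ** G) = G^star ** ((S x)^star ** S x ** G).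
  by rewrite !cstar_mulA.
by rewrite h1 cmul0r.
Qed.

Lemma defect4_cube x b c d : E (x ** x^star ** x) b c d = 0 -> E x b c d = 0.
Proof. by rewrite /E !tro_defect_shift; apply: cube_cancel. Qed.

(** For the commutator x of f and g, the first argument x x^star x is x x^star
    times a commutator on the right, where [defect4_comm] applies. *)
Lemma defect4_swap f g b c d : E (f ** g) b c d = E (g ** f) b c d.
Proof.
have EB u v : E (u - v) b c d = E u b c d - E v b c d.
  by rewrite /E !tro_defect_shift linearB cmulBl.
apply/subr0_eq; rewrite -EB; apply: defect4_cube; rewrite cmulBr EB.
by rewrite !(cstar_mulA _ f) !(cstar_mulA _ g) defect4_comm subrr.
Qed.

(** Moving v to the third argument, exchanging the outer arguments and
    reordering the factors returns the same expression with the opposite sign. *)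
Lemma defect4_prod u v b w d : E (u ** v) b w d = 0.
Proof.
have h : E (u ** v) b w d = - E (u ** v) b w d.
  rewrite {1}defect4_ac defect4_alt defect4_swap defect4_ac -defect4_alt.
  by rewrite defect4_swap defect4_alt -defect4_ac defect4_swap.
by apply: (@doubleI B); rewrite {1}h addNr.
Qed.

(** The defect D satisfies D S(d)^star = 0 for every d, and D is S of something
    minus S(a) S(b)^star S(c), so D D^star = 0. *)
Lemma balanced_tro : tro_homomorphism S.
Proof.
have E0 a b c d : E a b c d = 0 by apply: defect4_cube; exact: defect4_prod.
move=> a b c; apply: subr0_eq; apply: mul_adj_eq0.
rewrite -/(tro_defect a b c) {2}/tro_defect cadjB cmulBr [X in X - _]E0 sub0r.
by rewrite !cstar_adjM cstar_mulA [X in X ** _]E0 cmul0l oppr0.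
Qed.

End BalancedTriple.

(** * Polynomials in a self-adjoint element acting by right multiplication *)

Section PolyAction.
Variables (R : realType) (A : cstarAlgType R) (x : A).
Implicit Types (a b : A) (p q : {poly R}).

(** Powers of x are only available applied to an element of the algebra,
    which need not have a unit. *)
Definition cpow a i := iter i (fun b => b ** x) a.

Definition pact a p := \sum_(i < size p) (p`_i)%:C *: cpow a i.

Lemma pact_widen n a p : (size p <= n)%N ->
  pact a p = \sum_(i < n) (p`_i)%:C *: cpow a i.
Proof.
move=> h; rewrite /pact (big_ord_widen n (fun i => (p`_i)%:C *: cpow a i)) //.
rewrite big_mkcond /=; apply: eq_bigr => i _.
by case: ltnP => // hi; rewrite nth_default // scale0r.
Qed.

Lemma pactD a p q : pact a (p + q) = pact a p + pact a q.
Proof.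
pose n := maxn (size p) (size q).
rewrite !(@pact_widen n) ?leq_maxl ?leq_maxr ?size_polyD // -big_split /=.
by apply: eq_bigr => i _; rewrite coefD rmorphD scalerDl.
Qed.

Lemma pactZ a (k : R) p : pact a (k *: p) = k%:C *: pact a p.
Proof.
rewrite !(@pact_widen (size p)) ?size_scale_leq // scaler_sumr.
by apply: eq_bigr => i _; rewrite coefZ rmorphM scalerA.
Qed.

Lemma pactC a (k : R) : pact a k%:P = k%:C *: a.
Proof.
by rewrite (@pact_widen 1) ?size_polyC_leq1 // big_ord1 coefC /=.
Qed.

Lemma pact1 a : pact a 1 = a.
Proof. by rewrite -[1]/(1%:P) pactC scale1r. Qed.

Lemma pactMX a p : pact a (p * 'X) = pact a p ** x.
Proof.
rewrite (@pact_widen (size p).+1) ?(leq_trans (size_polyMleq _ _)) //.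
  rewrite big_ord_recl coefMX /= scale0r add0r cmul_suml.
  by apply: eq_bigr => i _; rewrite coefMX /= cstar_mulZl.
by rewrite size_polyX addn2.
Qed.

Lemma pactX a : pact a 'X = a ** x.
Proof. by rewrite -[X in pact a X]mul1r pactMX pact1. Qed.

Lemma pact0 a : pact a 0 = 0.
Proof. by rewrite /pact size_poly0 big_ord0. Qed.

Lemma pactN a p : pact a (- p) = - pact a p.
Proof. by rewrite -scaleN1r pactZ rmorphN scaleN1r. Qed.

Lemma pactB a p q : pact a (p - q) = pact a p - pact a q.
Proof. by rewrite pactD pactN. Qed.

Lemma pactM a p q : pact a (p * q) = pact (pact a p) q.
Proof.
elim/poly_ind: q => [|q c ih]; first by rewrite mulr0 !pact0.
rewrite mulrDr mulrA !pactD !pactMX ih pactC; congr (_ + _).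
by rewrite mulrC mul_polyC pactZ.
Qed.

Lemma pactMA a b p : pact (a ** b) p = a ** pact b p.
Proof.
elim/poly_ind: p => [|p c ih]; first by rewrite !pact0 cmul0r.
by rewrite !pactD !pactMX ih !pactC cstar_mulDr cstar_mulZr cstar_mulA.
Qed.

Hypothesis xsa : x^star = x.

(** This is where self-adjointness of x enters: real polynomials in x act as
    self-adjoint right multipliers. *)
Lemma pact_adj a b p : pact a p ** b^star = a ** (pact b p)^star.
Proof.
elim/poly_ind: p a b => [|p c ih] a b; first by rewrite !pact0 cadj0 cmul0l cmul0r.
rewrite !pactD !pactMX !pactC cstar_adjD cstar_mulDl cstar_mulDr; congr (_ + _).
  have -> : pact a p ** x ** b^star = pact a p ** (b ** x)^star.
    by rewrite cstar_adjM xsa cstar_mulA.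
  by rewrite ih -pactX -pactM mulrC pactMX.
rewrite cstar_adjZ cstar_mulZl cstar_mulZr; congr (_ *: _).
exact: esym (conjc_real _).
Qed.

Definition bnd p (M : R) := forall a, rnorm (pact a p) <= M * rnorm a.

Lemma bnd_le p M K : bnd p M -> M <= K -> bnd p K.
Proof.
by move=> h hMK a; rewrite (le_trans (h a)) // ler_wpM2r // rnorm_ge0.
Qed.

Lemma bndD p q M K : bnd p M -> bnd q K -> bnd (p + q) (M + K).
Proof.
by move=> h k a; rewrite pactD mulrDl (le_trans (rnormD _ _)) // lerD.
Qed.

Lemma bndM p q M K : bnd p M -> bnd q K -> 0 <= K -> bnd (p * q) (M * K).
Proof.
move=> h k K0 a; rewrite pactM (le_trans (k _)) //.
by rewrite [M * K]mulrC -mulrA ler_wpM2l.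
Qed.

Lemma bndZ p M (k : R) : bnd p M -> bnd (k *: p) (`|k| * M).
Proof. by move=> h a; rewrite pactZ rnormZr -mulrA ler_wpM2l. Qed.

Lemma bndC (k : R) : bnd k%:P `|k|.
Proof. by move=> a; rewrite pactC rnormZr. Qed.

Lemma bnd_closed p M : (forall e, 0 < e -> bnd p (M + e)) -> bnd p M.
Proof.
move=> h a; have [a0|a0] := eqVneq (rnorm a) 0.
  by have := h 1 ltr01 a; rewrite a0 !mulr0.
apply/ler_addgt0Pr => e e0.
have ap : 0 < rnorm a by rewrite lt0r a0 rnorm_ge0.
by have := h (e / rnorm a) (divr_gt0 e0 ap) a; rewrite mulrDl divfK.
Qed.

(** Put w = a p + i a q.  As p and q commute, w w^star = a (p^2 + q^2) a^star,
    so |w| is controlled, likewise for its conjugate v = a p - i a q, and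
    a p is their mean. *)
Lemma bnd_sq p q M : 0 <= M -> bnd (p ^+ 2 + q ^+ 2) (M ^+ 2) -> bnd p M.
Proof.
move=> M0 h a.
pose w := pact a p + 'i *: pact a q; pose v := pact a p - 'i *: pact a q.
have iJ : Num.conj ('i : R[i]) = - 'i by apply/eqP; rewrite eq_complex /= oppr0 !eqxx.
have ii : ('i : R[i]) * 'i = -1 by rewrite -expr2 sqr_i.
have key c : pact a p ** (pact c q)^star = pact a q ** (pact c p)^star.
  by rewrite !pact_adj -!pactM mulrC.
have E1 : pact a p ** (pact a p)^star + pact a q ** (pact a q)^star =
          pact a (p ^+ 2 + q ^+ 2) ** a^star.
  by rewrite pactD cstar_mulDl !pactM !pact_adj.
have E2 : w ** w^star = pact a (p ^+ 2 + q ^+ 2) ** a^star.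
  rewrite -E1 /w cstar_adjD cstar_adjZ iJ !cstar_mulDl !cstar_mulDr.
  rewrite !cstar_mulZr !cstar_mulZl !scaleNr scalerA ii scaleN1r opprK key.
  by rewrite -addrA; congr (_ + _); rewrite addrA addNr add0r.
have E3 : v ** v^star = pact a (p ^+ 2 + q ^+ 2) ** a^star.
  rewrite -E1 /v cadjB cstar_adjZ iJ scaleNr opprK cmulBl !cstar_mulDr.
  rewrite !cstar_mulZr !cstar_mulZl scalerA ii scaleN1r key.
  by rewrite opprD opprK -addrA; congr (_ + _); rewrite addrA subrr add0r.
have bd u : u ** u^star = pact a (p ^+ 2 + q ^+ 2) ** a^star -> rnorm u <= M * rnorm a.
  move=> hu; rewrite -(@ler_pXn2r _ 2) ?nnegrE ?rnorm_ge0 ?mulr_ge0 ?rnorm_ge0 //.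
  rewrite -rnorm_mul_adj hu (le_trans (rnormM _ _)) // rnorm_adj.
  by rewrite exprMn [X in _ <= _ * X]expr2 mulrA ler_wpM2r ?rnorm_ge0.
have -> : pact a p = (2^-1)%:C *: (w + v).
  have two (u : A) : u + u = (2 : R[i]) *: u by rewrite scaler_nat mulr2n.
  rewrite /w /v addrACA subrr addr0 two scalerA.
  suff -> : (2^-1 : R)%:C * 2 = 1 :> R[i] by rewrite scale1r.
  by rewrite -[2 : R[i]](rmorph_nat (real_complex R)) -rmorphM mulVf // pnatr_eq0.
rewrite rnormZr ger0_norm ?invr_ge0 // -ler_pdivlMl ?invr_gt0 // invrK.
by rewrite (le_trans (rnormD _ _)) // mulr_natl mulr2n lerD // bd.
Qed.

Lemma bndX M : rnorm x <= M -> bnd 'X M.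
Proof.
by move=> h a; rewrite pactX (le_trans (rnormM _ _)) // mulrC ler_wpM2r ?rnorm_ge0.
Qed.

End PolyAction.

(** * Positive polynomials of a self-adjoint contraction *)

Section Cone.
Variables (R : realType) (A : cstarAlgType R) (x : A).
Hypotheses (xsa : x^star = x) (x1 : rnorm x <= 1).
Implicit Types (a b : A) (p q s t : {poly R}) (M K e : R).
Local Notation bnd := (bnd x).

Lemma bnd1 : bnd 1 1.
Proof. by have := bndC x 1; rewrite normr1. Qed.

Lemma bndN p M : bnd p M -> bnd (- p) M.
Proof. by move=> h; have := bndZ (-1) h; rewrite normrN1 mul1r scaleN1r. Qed.

Lemma bndB p q M K : bnd p M -> bnd q K -> bnd (p - q) (M + K).
Proof. by move=> h k; apply: bndD => //; apply: bndN. Qed.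

Lemma bnd_ex p : exists2 M, 0 <= M & bnd p M.
Proof.
elim/poly_ind: p => [|p c [M M0 h]].
  by exists 0 => //; have := bndC x 0; rewrite normr0.
exists (M * 1 + `|c|); first by rewrite addr_ge0 // mulr_ge0.
by apply: bndD (bndM h (bndX x1) ler01) (bndC _ _).
Qed.

Lemma bnd_sq1 p M : 0 <= M -> bnd (p ^+ 2) (M ^+ 2) -> bnd p M.
Proof.
by move=> M0 h; apply: (@bnd_sq _ _ _ xsa p 0) => //; rewrite expr0n addr0.
Qed.

Lemma bnd_sqD s t M : 0 <= M -> bnd (s ^+ 2 + t ^+ 2) M -> bnd (s ^+ 2) M.
Proof.
move=> M0 h; have : bnd s (Num.sqrt M).
  by apply: (@bnd_sq _ _ _ xsa s t); rewrite ?sqrtr_ge0 // sqr_sqrtr.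
by move=> k; have := bndM k k (sqrtr_ge0 _); rewrite -!expr2 sqr_sqrtr.
Qed.

(** Picard iteration for q = (t + q^2) / 2, whose solution is
    q = 1 - sqrt (1 - t).  Every iterate has nonnegative coefficients in t, so
    its value at t = 1, the scalar iteration below, bounds its norm. *)
Fixpoint sqrt_iter t n : {poly R} :=
  if n is m.+1 then 2^-1 *: (t + sqrt_iter t m ^+ 2) else 0.

Fixpoint sqrt_iterR n : R :=
  if n is m.+1 then 2^-1 * (1 + sqrt_iterR m ^+ 2) else 0.

Lemma sqrt_iterS t n : sqrt_iter t n.+1 = 2^-1 *: (t + sqrt_iter t n ^+ 2).
Proof. by []. Qed.

Lemma sqrt_iterRS n : sqrt_iterR n.+1 = 2^-1 * (1 + sqrt_iterR n ^+ 2).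
Proof. by []. Qed.

Lemma sqrt_iterR_bound n : 0 <= sqrt_iterR n <= 1.
Proof.
elim: n => [|n /andP[h0 h1]] /=; first by rewrite lexx ler01.
have : sqrt_iterR n ^+ 2 <= 1 by rewrite expr_le1.
have := sqr_ge0 (sqrt_iterR n); move: (sqrt_iterR n ^+ 2) => y; lra.
Qed.

(** With d_n = 1 - sqrt_iterR n one has d_(n+1) = d_n - d_n^2 / 2; summing,
    and using that d_n decreases, gives n d_n^2 <= 2 (1 - d_n). *)
Lemma sqrt_iterR_rate n : n%:R * (1 - sqrt_iterR n) ^+ 2 <= 2 * sqrt_iterR n.
Proof.
elim: n => [|n ih]; first by rewrite /= !mul0r mulr0.
have /andP[h0 h1] := sqrt_iterR_bound n.
have k : (1 - sqrt_iterR n.+1) ^+ 2 <= (1 - sqrt_iterR n) ^+ 2.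
  rewrite ler_sqr ?nnegrE /=; nra.
have : n.+1%:R * (1 - sqrt_iterR n.+1) ^+ 2 <= n.+1%:R * (1 - sqrt_iterR n) ^+ 2.
  by rewrite ler_wpM2l.
have -> : n.+1%:R * (1 - sqrt_iterR n) ^+ 2 =
    n%:R * (1 - sqrt_iterR n) ^+ 2 + (1 - sqrt_iterR n) ^+ 2 by rewrite -natr1; ring.
have -> : 2 * sqrt_iterR n.+1 = 1 + sqrt_iterR n ^+ 2.
  by rewrite /= mulrA divff ?mul1r // pnatr_eq0.
move=> h.
apply: (le_trans h); rewrite -lerBrDr; apply: (le_trans ih).
by rewrite le_eqVlt; apply/orP; left; apply/eqP; ring.
Qed.

Lemma bnd_sqrt_iter t n : bnd t 1 -> bnd (sqrt_iter t n) (sqrt_iterR n).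
Proof.
move=> h; elim: n => [|n ih] /=.
  by have := bndC x 0; rewrite normr0.
have /andP[h0 h1] := sqrt_iterR_bound n.
have := bndZ (2^-1) (bndD h (bndM ih ih h0)).
by rewrite ger0_norm ?invr_ge0.
Qed.

Lemma bnd_sqrt_iterB t n : bnd t 1 ->
  bnd (sqrt_iter t n.+1 - sqrt_iter t n) (sqrt_iterR n.+1 - sqrt_iterR n).
Proof.
move=> h; elim: n => [|n ih].
  rewrite /= !subr0 !expr0n !addr0 mulr1.
  by have := bndZ (2^-1) h; rewrite ger0_norm ?invr_ge0 // mulr1.
have /andP[h0 h1] := sqrt_iterR_bound n; have /andP[k0 k1] := sqrt_iterR_bound n.+1.
have hD := bndD (bnd_sqrt_iter n.+1 h) (bnd_sqrt_iter n h).
have := bndZ (2^-1) (bndM ih hD (addr_ge0 k0 h0)).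
rewrite ger0_norm ?invr_ge0 // -!subr_sqr.
have -> : sqrt_iter t n.+2 - sqrt_iter t n.+1 =
    2^-1 *: (sqrt_iter t n.+1 ^+ 2 - sqrt_iter t n ^+ 2).
  by rewrite (sqrt_iterS t n.+1) {2}(sqrt_iterS t n) -scalerBr; congr (_ *: _); ring.
have -> : sqrt_iterR n.+2 - sqrt_iterR n.+1 =
    2^-1 * (sqrt_iterR n.+1 ^+ 2 - sqrt_iterR n ^+ 2).
  by rewrite (sqrt_iterRS n.+1) {2}(sqrt_iterRS n) -mulrBr; congr (_ * _); ring.
by [].
Qed.

Lemma sqrt_approx t e : bnd t 1 -> 0 < e -> exists s, bnd (1 - t - s ^+ 2) e.
Proof.
move=> h e0; pose n := (Num.truncn (2 / e)).+1.
exists (1 - sqrt_iter t n).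
have -> : 1 - t - (1 - sqrt_iter t n) ^+ 2 = - (2 *: (sqrt_iter t n.+1 - sqrt_iter t n)).
  rewrite /= scalerBr scalerA divff ?pnatr_eq0 // scale1r -!mul_polyC.
  by rewrite rmorph_nat; ring.
apply/bndN/(bnd_le (bndZ 2 (bnd_sqrt_iterB n h))).
rewrite ger0_norm // sqrt_iterRS mulrBr mulrA divff ?pnatr_eq0 // mul1r.
have -> : 1 + sqrt_iterR n ^+ 2 - 2 * sqrt_iterR n = (1 - sqrt_iterR n) ^+ 2 by ring.
have n0 : (0 : R) < n%:R by rewrite ltr0n.
rewrite -(ler_pM2l n0); apply: (le_trans (sqrt_iterR_rate n)).
have : 2 / e < n%:R by rewrite truncnS_gt.
by rewrite ltr_pdivrMr //; have /andP[_ k] := sqrt_iterR_bound n; lra.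
Qed.

(** Approximate squares: exact square roots need not be polynomials. *)
Definition pos p := forall e, 0 < e -> exists s, bnd (p - s ^+ 2) e.

Lemma pos_sq s : pos (s ^+ 2).
Proof.
move=> e e0; exists s; rewrite subrr.
by apply: (@bnd_le _ _ _ _ 0); rewrite ?ltW //; have := bndC x 0; rewrite normr0.
Qed.

(** If p is close to s^2 and M - p to t^2, then s^2 + t^2 is close to M, and a
    square is dominated in norm by a sum of two squares. *)
Lemma pos_bnd p M : pos p -> pos (M%:P - p) -> 0 <= M -> bnd p M.
Proof.
move=> hp hq M0; apply: bnd_closed => e e0.
have e3 : 0 < e / 3 by lra.
have [s hs] := hp _ e3; have [t ht] := hq _ e3.
have : bnd (s ^+ 2 + t ^+ 2) (M + (e / 3 + e / 3)).
  have -> : s ^+ 2 + t ^+ 2 = M%:P - ((p - s ^+ 2) + (M%:P - p - t ^+ 2)) by ring.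
  apply: bndB; last exact: bndD.
  by have := bndC x M; rewrite ger0_norm.
move/bnd_sqD => /(_ ltac:(lra)) k.
have -> : p = (p - s ^+ 2) + s ^+ 2 by ring.
by apply: (bnd_le (bndD hs k)); lra.
Qed.

Lemma bnd_1Bsq s : bnd (s ^+ 2) 1 -> bnd (1 - s ^+ 2) 1.
Proof.
move=> h; apply: pos_bnd => //.
  by move=> e e0; apply: sqrt_approx.
have -> : 1%:P - (1 - s ^+ 2) = s ^+ 2 by ring.
exact: pos_sq.
Qed.

Lemma pos_scale p (k : R) : 0 <= k -> pos p -> pos (k *: p).
Proof.
move=> k0 h e e0; have [s hs] := h (e / (k + 1)) ltac:(apply: divr_gt0; lra).
exists (Num.sqrt k *: s).
rewrite exprZn sqr_sqrtr // -scalerBr.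
apply: (bnd_le (bndZ k hs)); rewrite ger0_norm // mulrA ler_pdivrMr; nra.
Qed.

Lemma pos_lim p : (forall e, 0 < e -> exists2 q, pos q & bnd (p - q) e) -> pos p.
Proof.
move=> h e e0; have e2 : 0 < e / 2 by lra.
have [q hq hpq] := h _ e2; have [s hs] := hq _ e2.
exists s; have -> : p - s ^+ 2 = (p - q) + (q - s ^+ 2) by ring.
by apply: (bnd_le (bndD hpq hs)); lra.
Qed.

(** After scaling, u = s^2 and v = t^2 satisfy |1 - u| <= 1 and |1 - v| <= 1.
    The mean of u and v is then within 1 of 1 as well, so that it has
    approximate square roots. *)
Lemma pos_sqD s t : pos (s ^+ 2 + t ^+ 2).
Proof.
have [M M0 hM] := bnd_ex (s ^+ 2); have [K K0 hK] := bnd_ex (t ^+ 2).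
pose L := M + K + 1; have L0 : 0 < L by rewrite /L; lra.
have sc (u : {poly R}) N : N <= L -> bnd (u ^+ 2) N ->
    bnd (1 - L^-1 *: (u ^+ 2)) 1.
  move=> NL hu.
  have E : L^-1 *: u ^+ 2 = (Num.sqrt (L^-1) *: u) ^+ 2.
    by rewrite exprZn sqr_sqrtr // invr_ge0 ltW.
  rewrite E; apply: bnd_1Bsq; rewrite -E.
  apply: (bnd_le (bndZ _ hu)); rewrite ger0_norm ?invr_ge0 ?(ltW L0) //.
  by rewrite mulrC ler_pdivrMr // mul1r.
have hs := sc _ M ltac:(rewrite /L; lra) hM.
have ht := sc _ K ltac:(rewrite /L; lra) hK.
have hu : bnd (1 - (2 * L)^-1 *: (s ^+ 2 + t ^+ 2)) 1.
  have -> : 1 - (2 * L)^-1 *: (s ^+ 2 + t ^+ 2) =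
    2^-1 *: ((1 - L^-1 *: (s ^+ 2)) + (1 - L^-1 *: (t ^+ 2))).
    rewrite invfM -scalerA [L^-1 *: (_ + _)]scalerDr.
    set u := L^-1 *: _; set v := L^-1 *: _.
    have -> : 1 - u + (1 - v) = 2%:P - (u + v) by rewrite rmorph_nat; ring.
    by rewrite scalerBr; congr (_ - _); rewrite -mul_polyC -polyCM mulVf ?pnatr_eq0.
  by apply: (bnd_le (bndZ _ (bndD hs ht))); rewrite ger0_norm ?invr_ge0 //; lra.
have -> : s ^+ 2 + t ^+ 2 = (2 * L) *: (1 - (1 - (2 * L)^-1 *: (s ^+ 2 + t ^+ 2))).
  rewrite opprB addrCA subrr addr0 scalerA divff ?scale1r //.
  by rewrite mulf_neq0 ?pnatr_eq0 // gt_eqF.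
apply: pos_scale; first by lra.
by move=> e e0; apply: sqrt_approx.
Qed.

Lemma posD p q : pos p -> pos q -> pos (p + q).
Proof.
move=> hp hq; apply: pos_lim => e e0; have e2 : 0 < e / 2 by lra.
have [s hs] := hp _ e2; have [t ht] := hq _ e2.
exists (s ^+ 2 + t ^+ 2); first exact: pos_sqD.
have -> : p + q - (s ^+ 2 + t ^+ 2) = (p - s ^+ 2) + (q - t ^+ 2) by ring.
by apply: (bnd_le (bndD hs ht)); lra.
Qed.

Lemma posM p q : pos p -> pos q -> pos (p * q).
Proof.
move=> hp hq; apply: pos_lim => e e0.
have [M M0 hM] := bnd_ex p; have [K K0 hK] := bnd_ex q.
(* d <= 1 bounds t^2 by K + 1, and the total error is d (M + K + 1). *)
pose d := Num.min 1 (e / (M + K + 1)).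
have d0 : 0 < d by rewrite lt_min ltr01 /= divr_gt0 //; lra.
have [s hs] := hp _ d0; have [t ht] := hq _ d0.
exists ((s * t) ^+ 2); first exact: pos_sq.
have d1 : d <= 1 by rewrite ge_min lexx.
have dK : d * (M + K + 1) <= e.
  by rewrite -ler_pdivlMr ?ge_min ?lexx ?orbT //; lra.
have ht2 : bnd (t ^+ 2) (K + 1).
  have -> : t ^+ 2 = q - (q - t ^+ 2) by ring.
  by apply: (bnd_le (bndB hK ht)); lra.
have -> : p * q - (s * t) ^+ 2 = p * (q - t ^+ 2) + (p - s ^+ 2) * t ^+ 2 by ring.
have d0' := ltW d0.
apply: (bnd_le (bndD (bndM hM ht d0') (bndM hs ht2 _))); lra.
Qed.

Lemma pos_C (k : R) : 0 <= k -> pos k%:P.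
Proof.
move=> k0; rewrite -[k]sqr_sqrtr // rmorphXn; exact: pos_sq.
Qed.

(** (M - p) (M + p) = M^2 - p^2 is positive, which reduces the claim to the
    one-sided bound for p^2. *)
Lemma pos_abs_bnd p M : 0 <= M -> pos (M%:P - p) -> pos (M%:P + p) -> bnd p M.
Proof.
move=> M0 h k; apply: bnd_sq1 => //; apply: pos_bnd; rewrite ?sqr_ge0 //.
  exact: pos_sq.
have -> : (M ^+ 2)%:P - p ^+ 2 = (M%:P - p) * (M%:P + p) by rewrite rmorphXn /=; ring.
exact: posM.
Qed.

Lemma pos_1B t : bnd t 1 -> pos (1 - t).
Proof. by move=> h e e0; apply: sqrt_approx. Qed.

End Cone.

(** * Bernstein polynomials and their moments *)

Section BernsteinAlgebra.
Variable (R : realType).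
Implicit Types (g k : nat -> {poly R}).

(** The variable moved from [-1, 1] to [0, 1], where Bernstein polynomials live. *)
Definition unit_var : {poly R} := 2^-1 *: (1 + 'X).

(** The expectation of g under n Bernoulli trials of success probability
    unit_var.  The recursion on the first trial gives positivity and all
    moments by induction, without binomial coefficients. *)
Fixpoint bern n g : {poly R} :=
  if n is m.+1 then unit_var * bern m (fun i => g i.+1) + (1 - unit_var) * bern m g
  else g 0%N.

Lemma eq_bern_le n g k :
  (forall i, (i <= n)%N -> g i = k i) -> bern n g = bern n k.
Proof.
elim: n g k => [|n ih] g k h /=; first exact: h.
by congr (_ * _ + _ * _); apply: ih => i hi; apply: h => //; apply: leqW.
Qed.

Lemma eq_bern n g k : (forall i, g i = k i) -> bern n g = bern n k.
Proof. by move=> h; apply: eq_bern_le. Qed.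

Lemma bernD n g k : bern n (fun i => g i + k i) = bern n g + bern n k.
Proof. by elim: n g k => [|n ih] g k //=; rewrite !ih; ring. Qed.

Lemma bernMr n g (c : {poly R}) : bern n (fun i => c * g i) = c * bern n g.
Proof. by elim: n g => [|n ih] g //=; rewrite !ih; ring. Qed.

Lemma bernMl n g (c : {poly R}) : bern n (fun i => g i * c) = bern n g * c.
Proof. by elim: n g => [|n ih] g //=; rewrite !ih; ring. Qed.

Lemma bernB n g k : bern n (fun i => g i - k i) = bern n g - bern n k.
Proof. by elim: n g k => [|n ih] g k //=; rewrite !ih; ring. Qed.

Lemma bern_const n (c : {poly R}) : bern n (fun=> c) = c.
Proof. by elim: n => [|n ih] //=; rewrite !ih; ring. Qed.

Lemma bern_id n : bern n (fun i => i%:R) = n%:R * unit_var.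
Proof.
elim: n => [|n ih] /=; first by rewrite mul0r.
rewrite (@eq_bern _ _ (fun i => i%:R + 1)) => [|i]; last by rewrite natr1.
by rewrite bernD bern_const ih -(natr1 n); ring.
Qed.

Lemma bern_sqr n :
  bern n (fun i => i%:R ^+ 2) = n%:R ^+ 2 * unit_var ^+ 2 + n%:R * (unit_var * (1 - unit_var)).
Proof.
elim: n => [|n ih] /=; first by rewrite expr0n /= !mul0r addr0.
rewrite (@eq_bern _ _ (fun i => i%:R ^+ 2 + (2 * i%:R + 1))) => [|i].
  by rewrite !bernD bernMr bern_const bern_id ih -(natr1 n); ring.
by rewrite -natr1; ring.
Qed.

Lemma bern_quad n (a b c : {poly R}) :
  bern n (fun i => a + b * i%:R + c * i%:R ^+ 2) =
  a + b * (n%:R * unit_var) + c * (n%:R ^+ 2 * unit_var ^+ 2 + n%:R * (unit_var * (1 - unit_var))).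
Proof. by rewrite !bernD !bernMr bern_const bern_id bern_sqr. Qed.

Lemma bern_prod n m g k :
  bern n g * bern m k = bern n (fun i => bern m (fun j => g i * k j)).
Proof. by rewrite -bernMl; apply: eq_bern => i; rewrite bernMr. Qed.

(** The difference of two independent sample means has mean 0, and its variance
    is the sum of the two variances. *)
Lemma bern_variance n m (e K : R) :
  bern n.+1 (fun i => bern m.+1 (fun j =>
    (e + K * (i%:R / n.+1%:R - j%:R / m.+1%:R) ^+ 2)%:P)) =
  e%:P + (K * (n.+1%:R^-1 + m.+1%:R^-1))%:P * (unit_var * (1 - unit_var)).
Proof.
set u := (n.+1%:R)^-1; set v := (m.+1%:R)^-1.
have Nu : n.+1%:R * u%:P = 1.
  by rewrite -[n.+1%:R](rmorph_nat polyC) -polyCM divff ?pnatr_eq0.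
have Mv : m.+1%:R * v%:P = 1.
  by rewrite -[m.+1%:R](rmorph_nat polyC) -polyCM divff ?pnatr_eq0.
pose N : {poly R} := n.+1%:R; pose M : {poly R} := m.+1%:R.
rewrite (@eq_bern _ _ (fun i =>
   (e%:P + K%:P * v%:P ^+ 2 * (M ^+ 2 * unit_var ^+ 2 + M * (unit_var * (1 - unit_var)))) +
   (- 2 * (K%:P * u%:P * v%:P) * (M * unit_var)) * i%:R +
   (K%:P * u%:P ^+ 2) * i%:R ^+ 2)); last first.
  move=> i; rewrite (@eq_bern _ _ (fun j =>
    (e%:P + K%:P * u%:P ^+ 2 * i%:R ^+ 2) +
    (- 2 * (K%:P * u%:P * v%:P) * i%:R) * j%:R + (K%:P * v%:P ^+ 2) * j%:R ^+ 2)).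
    by rewrite bern_quad -/M; ring.
  by move=> j; ring.
rewrite bern_quad -/N.
have -> : e%:P + K%:P * v%:P ^+ 2 * (M ^+ 2 * unit_var ^+ 2 + M * (unit_var * (1 - unit_var))) +
    - 2 * (K%:P * u%:P * v%:P) * (M * unit_var) * (N * unit_var) +
    K%:P * u%:P ^+ 2 * (N ^+ 2 * unit_var ^+ 2 + N * (unit_var * (1 - unit_var))) =
  e%:P + K%:P * ((M * v%:P) ^+ 2 * unit_var ^+ 2 + (M * v%:P) * v%:P * (unit_var * (1 - unit_var)) -
    2 * (M * v%:P) * (N * u%:P) * unit_var ^+ 2 +
    (N * u%:P) ^+ 2 * unit_var ^+ 2 + (N * u%:P) * u%:P * (unit_var * (1 - unit_var))) by ring.
by rewrite Nu Mv; ring.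
Qed.

(** Degree n + 1 instead of n, so that the nodes i / (n + 1) make sense for all n. *)
Definition bernf n (h : R -> R) : {poly R} :=
  bern n.+1 (fun i => (h (i%:R / n.+1%:R))%:P).

Lemma bernf_id n : bernf n id = unit_var.
Proof.
rewrite /bernf (@eq_bern _ _ (fun i => (n.+1%:R^-1)%:P * i%:R)).
  have E : (n.+1%:R : {poly R}) = (n.+1%:R)%:P by rewrite rmorph_nat.
  rewrite bernMr bern_id mulrA E -polyCM mulVf ?mul1r // pnatr_eq0.
by move=> i; rewrite mulrC polyCM rmorph_nat.
Qed.

Lemma bernfD n (h k : R -> R) :
  bernf n (fun t => h t + k t) = bernf n h + bernf n k.
Proof. by rewrite /bernf -bernD; apply: eq_bern => i; rewrite polyCD. Qed.

Lemma bernfZ n (c : R) (h : R -> R) :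
  bernf n (fun t => c * h t) = c *: bernf n h.
Proof.
by rewrite /bernf -mul_polyC -bernMr; apply: eq_bern => i; rewrite polyCM.
Qed.

Lemma eq_bernf n (h k : R -> R) :
  (forall t, 0 <= t <= 1 -> h t = k t) -> bernf n h = bernf n k.
Proof.
move=> hk; apply: eq_bern_le => i hi; rewrite hk // divr_ge0 //=.
by rewrite ler_pdivrMr ?ltr0n // mul1r ler_nat.
Qed.

Lemma bernf_const n c : bernf n (fun=> c) = c%:P.
Proof. exact: bern_const. Qed.

End BernsteinAlgebra.

(** * Norm estimates for Bernstein polynomials *)

Section BernsteinBound.
Variables (R : realType) (A : cstarAlgType R) (x : A).
Hypotheses (xsa : x^star = x) (x1 : rnorm x <= 1).
Local Notation bnd := (bnd x).
Local Notation pos := (pos x).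
Local Notation unit_var := (unit_var R).

Lemma pos_unit_var : pos unit_var.
Proof.
apply: pos_scale => //.
have := pos_1B (bndN (bndX x1)); rewrite opprK; exact.
Qed.

Lemma pos_1Bunit_var : pos (1 - unit_var).
Proof.
have -> : 1 - unit_var = 2^-1 *: (1 - 'X).
  rewrite /unit_var -{1}[1](@scale1r R) -[X in X *: _](mulVf (x := 2)) ?pnatr_eq0 //.
  rewrite -scalerA -scalerBr; congr (_ *: _).
  by rewrite -mul_polyC rmorph_nat; ring.
apply: pos_scale => //; exact: pos_1B (bndX x1).
Qed.

Lemma bern_pos n g : (forall i, pos (g i)) -> pos (bern n g).
Proof.
elim: n g => [|n ih] g h /=; first exact: h.
apply: posD => //; apply: posM => //; try exact: ih.
- exact: pos_unit_var.
- exact: pos_1Bunit_var.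
Qed.

(** Chebyshev: the double expectation of c is dominated, in the order of
    polynomials, by that of its quadratic majorant, which [bern_variance]
    evaluates. *)
Lemma bern2_bnd n m (c : nat -> nat -> R) (e K : R) : 0 <= e -> 0 <= K ->
  (forall i j, `|c i j| <= e + K * (i%:R / n.+1%:R - j%:R / m.+1%:R) ^+ 2) ->
  bnd (bern n.+1 (fun i => bern m.+1 (fun j => (c i j)%:P)))
      (e + K * (n.+1%:R^-1 + m.+1%:R^-1)).
Proof.
move=> e0 K0 hc; set r := _ + _^-1.
have r0 : 0 <= r by rewrite addr_ge0 ?invr_ge0.
pose d i j : R := e + K * (i%:R / n.+1%:R - j%:R / m.+1%:R) ^+ 2.
set p := bern _ _; set q := (e + K * r)%:P.
pose D := bern n.+1 (fun i => bern m.+1 (fun j => (d i j)%:P)).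
have hD : pos (q - D).
  rewrite /D bern_variance -/r /q.
  have -> : (e + K * r)%:P - (e%:P + (K * r)%:P * (unit_var * (1 - unit_var))) =
    (K * r)%:P * (unit_var ^+ 2 + unit_var * (1 - unit_var) + (1 - unit_var) ^+ 2) by ring.
  apply: posM => //; first by apply: pos_C; rewrite mulr_ge0.
  apply: posD => //; last exact: pos_sq.
  apply: posD => //; first exact: pos_sq.
  by apply: posM => //; [exact: pos_unit_var | exact: pos_1Bunit_var].
apply: pos_abs_bnd => //; first by rewrite addr_ge0 // mulr_ge0.
- have -> : q - p = (q - D) + (D - p) by ring.
  apply: posD => //; rewrite /D /p -bernB; apply: bern_pos => i.
  rewrite -bernB; apply: bern_pos => j; rewrite -polyCB; apply: pos_C.
  by rewrite subr_ge0 (le_trans (ler_norm _)) // hc.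
- have -> : q + p = (q - D) + (D + p) by ring.
  apply: posD => //; rewrite /D /p -bernD; apply: bern_pos => i.
  rewrite -bernD; apply: bern_pos => j; rewrite -polyCD; apply: pos_C.
  by rewrite addrC -lerBlDr sub0r lerNnormlW ?hc.
Qed.

Definition lipschitz1 (L : R) (h : R -> R) :=
  forall s t, `|h s - h t| <= L * `|s - t|.

(** A Lipschitz bound is turned into the quadratic majorant of Chebyshev. *)
Lemma lin_quad (L e u : R) : 0 < e -> L * `|u| <= e + L ^+ 2 / e * u ^+ 2.
Proof.
move=> e0; rewrite -(ler_pM2r e0) mulrDl mulrAC [_ / e * _ * _]mulrAC divfK ?gt_eqF //.
rewrite -(real_normK (num_real u)); have := normr_ge0 u; move: `|u| => v v0.
nra.
Qed.

Lemma bernf_bnd n h M : (forall t, `|h t| <= M) -> bnd (bernf n h) M.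
Proof.
move=> hM; have M0 : 0 <= M by apply: le_trans (normr_ge0 _) (hM 0).
apply: pos_abs_bnd => //.
- rewrite -(bern_const n.+1 M%:P) -bernB; apply: bern_pos => i.
  by rewrite -polyCB; apply: pos_C; rewrite subr_ge0 (le_trans (ler_norm _)).
- rewrite -(bern_const n.+1 M%:P) -bernD; apply: bern_pos => i.
  rewrite -polyCD; apply: pos_C.
  by rewrite addrC -lerBlDr sub0r lerNnormlW.
Qed.

Lemma bernf_cauchy n m h L e : lipschitz1 L h -> 0 < e ->
  bnd (bernf n h - bernf m h) (e + L ^+ 2 / e * (n.+1%:R^-1 + m.+1%:R^-1)).
Proof.
move=> hL e0.
have -> : bernf n h - bernf m h =
  bern n.+1 (fun i => bern m.+1 (fun j =>
    (h (i%:R / n.+1%:R) - h (j%:R / m.+1%:R))%:P)).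
  rewrite -[bernf m h](bern_const n.+1) /bernf -bernB; apply: eq_bern => i.
  rewrite -[X in X - _](bern_const m.+1) -bernB; apply: eq_bern => j.
  by rewrite polyCB.
apply: bern2_bnd; [exact: ltW|by rewrite divr_ge0 ?sqr_ge0 ?(ltW e0)|].
by move=> i j; apply: le_trans (hL _ _) _; exact: lin_quad.
Qed.

(** Since h k = 0, the value h(s) k(t) is h(s) (k(t) - k(s)), which is small
    when s and t are close. *)
Lemma bernf_prod0 n m h k L e : lipschitz1 L k -> (forall t, `|h t| <= 1) ->
  (forall t, h t * k t = 0) -> 0 < e ->
  bnd (bernf n h * bernf m k) (e + L ^+ 2 / e * (n.+1%:R^-1 + m.+1%:R^-1)).
Proof.
move=> hL h1 hk e0.
have -> : bernf n h * bernf m k =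
  bern n.+1 (fun i => bern m.+1 (fun j =>
    (h (i%:R / n.+1%:R) * k (j%:R / m.+1%:R))%:P)).
  by rewrite /bernf bern_prod; apply: eq_bern => i; apply: eq_bern => j; rewrite polyCM.
apply: bern2_bnd; [exact: ltW|by rewrite divr_ge0 ?sqr_ge0 ?(ltW e0)|].
move=> i j; set s := _ / _; set t := _ / _.
have -> : h s * k t = h s * (k t - k s) by rewrite mulrBr hk subr0.
rewrite normrM (le_trans _ (lin_quad _ _ e0)) //.
rewrite (le_trans (ler_wpM2r _ (h1 s))) // mul1r (le_trans (hL _ _)) //.
by rewrite distrC.
Qed.

End BernsteinBound.

(** * Convergent sequences *)

Section Limits.
Variables (R : realType) (A : cstarAlgType R).
Implicit Types (u v : nat -> A) (l m : A).

Lemma cvg_rnormP u l : (u @ \oo --> l) <->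
  (forall e : R, 0 < e -> exists N, forall n, (N <= n)%N -> rnorm (u n - l) <= e).
Proof.
split=> [h e e0|h].
  have e0' : (0 : R[i]) < e%:C by rewrite ltcR.
  have /cvgrPdist_le /(_ _ e0') [N _ hN] := h.
  by exists N => n /hN /=; rewrite distrC rnormE lecR.
apply/cvgrPdist_le => e e0.
have eE : e = (complex.Re e)%:C by rewrite RRe_real // gtr0_real.
have [|N hN] := h (complex.Re e); first by rewrite -ltcR -eE.
exists N => // n /= /hN hn; rewrite distrC rnormE eE lecR; exact: hn.
Qed.

Lemma cauchy_rnorm_cvg u :
  (forall e : R, 0 < e ->
     exists N, forall n k, (N <= n)%N -> (N <= k)%N -> rnorm (u n - u k) <= e) ->
  cvg (u @ \oo).
Proof.
move=> h; apply/cauchy_cvgP/cauchy_exP => e e0.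
have eE : e = (complex.Re e)%:C by rewrite RRe_real // gtr0_real.
have r0 : 0 < complex.Re e by rewrite -ltcR -eE.
have [|N hN] := h (complex.Re e / 2); first by rewrite divr_gt0.
exists (u N), N => // n /= hn.
rewrite -ball_normE /ball_ /= rnormE eE ltcR.
by apply: (le_lt_trans (hN _ _ _ hn)) => //; lra.
Qed.

Lemma cvg_mul_adj u v l m : u @ \oo --> l -> v @ \oo --> m ->
  (fun n => u n ** (v n)^star) @ \oo --> l ** m^star.
Proof.
move=> /cvg_rnormP hu /cvg_rnormP hv; apply/cvg_rnormP => e e0.
have l0 := rnorm_ge0 l; have m0 := rnorm_ge0 m.
pose d := Num.min 1 (e / (rnorm l + rnorm m + 1)).
have d0 : 0 < d by rewrite lt_min ltr01 /= divr_gt0 //; lra.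
have [N hN] := hu _ d0; have [K hK] := hv _ d0.
exists (maxn N K) => n; rewrite geq_max => /andP[/hN h1 /hK h2].
have d1 : d <= 1 by rewrite ge_min lexx.
have de : d * (rnorm l + rnorm m + 1) <= e.
  by rewrite -ler_pdivlMr ?ge_min ?lexx ?orbT //; lra.
have -> : u n ** (v n)^star - l ** m^star =
   (u n - l) ** m^star + l ** (v n - m)^star + (u n - l) ** (v n - m)^star.
  rewrite cadjB !cmulBl !cmulBr.
  by rewrite -[RHS]addrA [in RHS](addrC (_ - _) (_ - _ - _)) subrK addrC subrKA.
have q0 := rnorm_ge0 (u n - l); have s0 := rnorm_ge0 (v n - m).
have t1 : rnorm ((u n - l) ** m^star) <= d * rnorm m.
  by rewrite (le_trans (rnormM _ _)) // rnorm_adj ler_wpM2r.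
have t2 : rnorm (l ** (v n - m)^star) <= rnorm l * d.
  by rewrite (le_trans (rnormM _ _)) // rnorm_adj ler_wpM2l.
have t3 : rnorm ((u n - l) ** (v n - m)^star) <= d * 1.
  by rewrite (le_trans (rnormM _ _)) // rnorm_adj ler_pM // (le_trans h2).
have := rnormD ((u n - l) ** m^star) (l ** (v n - m)^star).
have := rnormD ((u n - l) ** m^star + l ** (v n - m)^star)
  ((u n - l) ** (v n - m)^star).
lra.
Qed.

End Limits.

(** * Lipschitz functional calculus *)

Section FunctionalCalculus.
Variables (R : realType) (A : cstarAlgType R) (x : A).
Hypotheses (xsa : x^star = x) (x1 : rnorm x <= 1).
Implicit Types (h k : R -> R) (a b : A).

Definition fcalc h a : A := lim ((fun n => pact x a (bernf n h)) @ \oo).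

Lemma small_rate (e K : R) : 0 < e -> 0 <= K ->
  exists N, forall n m, (N <= n)%N -> (N <= m)%N ->
    e / 2 + K * (n.+1%:R^-1 + m.+1%:R^-1) <= e.
Proof.
move=> e0 K0; pose N := Num.truncn (4 * K / e).
have hN : 4 * K / e < N.+1%:R by rewrite truncnS_gt.
exists N => n m hn hm.
have bd p : (N <= p)%N -> K * p.+1%:R^-1 <= e / 4.
  move=> hp; rewrite ler_pdivrMr ?ltr0n //.
  rewrite ltr_pdivrMr // in hN.
  have : N.+1%:R * e <= p.+1%:R * e by rewrite ler_pM2r // ler_nat.
  lra.
have := bd _ hn; have := bd _ hm; rewrite mulrDr.
by move: (K * _) (K * _) => P Q; lra.
Qed.

Lemma fcalc_cvg h L a : lipschitz1 L h ->
  (fun n => pact x a (bernf n h)) @ \oo --> fcalc h a.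
Proof.
move=> hL; apply: cauchy_rnorm_cvg => e e0.
have a0 := rnorm_ge0 a.
pose d := e / (rnorm a + 1).
have d0 : 0 < d by rewrite divr_gt0 //; lra.
have d20 : 0 < d / 2 by rewrite divr_gt0.
have [|N hN] := @small_rate d (L ^+ 2 / (d / 2)) d0.
  by rewrite divr_ge0 ?sqr_ge0 // ltW.
exists N => n m hn hm; rewrite -pactB.
have := bernf_cauchy xsa x1 n m hL d20 a.
move=> /le_trans; apply.
apply: (@le_trans _ _ (d * rnorm a)); first by rewrite ler_wpM2r // hN.
rewrite /d mulrAC ler_pdivrMr; nra.
Qed.

Lemma fcalcD h k L M a : lipschitz1 L h -> lipschitz1 M k ->
  fcalc (fun t => h t + k t) a = fcalc h a + fcalc k a.
Proof.
move=> hL hM; apply: cvg_lim => //.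
rewrite (_ : (fun n => _) =
    (fun n => pact x a (bernf n h) + pact x a (bernf n k))).
  exact: cvgD (fcalc_cvg hL) (fcalc_cvg hM).
by apply/funext => n; rewrite bernfD pactD.
Qed.

Lemma fcalcZ c h L a : lipschitz1 L h ->
  fcalc (fun t => c * h t) a = c%:C *: fcalc h a.
Proof.
move=> hL; apply: cvg_lim => //.
rewrite (_ : (fun n => _) = (fun n => c%:C *: pact x a (bernf n h))).
  exact: cvgZr (fcalc_cvg hL).
by apply/funext => n; rewrite bernfZ pactZ.
Qed.

Lemma eq_fcalc h k a :
  (forall t, 0 <= t <= 1 -> h t = k t) -> fcalc h a = fcalc k a.
Proof.
move=> hk; rewrite /fcalc; congr (lim (_ @ \oo)).
by apply/funext => n; rewrite (eq_bernf n hk).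
Qed.

Lemma fcalc_id a : fcalc id a = pact x a (unit_var R).
Proof.
apply: cvg_lim => //.
rewrite (_ : (fun n => _) = (fun=> pact x a (unit_var R))); first exact: cvg_cst.
by apply/funext => n; rewrite bernf_id.
Qed.

Lemma fcalc_const c a : fcalc (fun=> c) a = c%:C *: a.
Proof.
apply: cvg_lim => //.
rewrite (_ : (fun n => _) = (fun=> c%:C *: a)); first exact: cvg_cst.
by apply/funext => n; rewrite bernf_const pactC.
Qed.

Lemma fcalc_bnd h L M a : lipschitz1 L h -> (forall t, `|h t| <= M) ->
  rnorm (fcalc h a) <= M * rnorm a.
Proof.
move=> hL hM; apply/ler_addgt0Pr => e e0.
have /cvg_rnormP/(_ _ e0) [N hN] := fcalc_cvg (a := a) hL.
have h1 := hN _ (leqnn N); have h2 := bernf_bnd xsa x1 N hM a.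
rewrite -[fcalc h a](subKr (pact x a (bernf N h))).
by rewrite (le_trans (rnormB _ _)) // lerD.
Qed.

Lemma fcalc_ortho h k L M a b : lipschitz1 L h -> lipschitz1 M k ->
  (forall t, `|h t| <= 1) -> (forall t, h t * k t = 0) ->
  fcalc h a ** (fcalc k b)^star = 0.
Proof.
move=> hL hM h1 hk.
have := cvg_mul_adj (fcalc_cvg (a := a) hL) (fcalc_cvg (a := b) hM).
set u := (fun n => _) => hu.
suff : u @ \oo --> (0 : A) by move/(cvg_unique (@norm_hausdorff _ _) hu).
apply/cvg_rnormP => e e0.
have a0 := rnorm_ge0 a; have b0 := rnorm_ge0 b.
have ab0 : 0 <= rnorm a * rnorm b by rewrite mulr_ge0.
pose d := e / (rnorm a * rnorm b + 1).
have d0 : 0 < d by rewrite divr_gt0 //; lra.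
have d20 : 0 < d / 2 by rewrite divr_gt0.
have [|N hN] := @small_rate d (M ^+ 2 / (d / 2)) d0.
  by rewrite divr_ge0 ?sqr_ge0 // ltW.
exists N => n hn; rewrite subr0 /u -pact_adj // -pactM.
rewrite (le_trans (rnormM _ _)) // rnorm_adj.
have := bernf_prod0 xsa x1 n n hM h1 hk d20 a.
move=> /(ler_wpM2r b0) /le_trans; apply.
apply: (@le_trans _ _ (d * rnorm a * rnorm b)).
  by rewrite !ler_wpM2r // hN.
rewrite /d -mulrA mulrAC ler_pdivrMr; nra.
Qed.

End FunctionalCalculus.

(** * The geometric series *)

Section Neumann.
Variables (R : realType) (A : cstarAlgType R).

(** The partial sums u_n of the geometric series satisfy
    u_(n+m) - u_n = T^n u_m and stay bounded by |a| / (1 - rho). *)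
Lemma neumann (T : A -> A) (rho : R) (a : A) :
  (forall u v, T (u - v) = T u - T v) ->
  (forall v, rnorm (T v) <= rho * rnorm v) -> 0 <= rho < 1 ->
  exists w, w = a + T w.
Proof.
move=> TB Tb /andP[r0 r1].
pose u n := iter n (fun v => a + T v) 0.
have uS n : u n.+1 = a + T (u n) by [].
pose C := rnorm a / (1 - rho).
have C0 : 0 <= C by rewrite divr_ge0 ?rnorm_ge0 // subr_ge0 ltW.
have uC n : rnorm (u n) <= C.
  elim: n => [|n ih] /=; first by rewrite rnorm0.
  rewrite (le_trans (rnormD _ _)) //.
  have -> : C = rnorm a + rho * C by rewrite /C; field; rewrite subr_eq0 gt_eqF.
  by rewrite lerD2l (le_trans (Tb _)) // ler_wpM2l.
have ud n m : rnorm (u (n + m)%N - u n) <= rho ^+ n * C.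
  elim: n m => [|n ih] m; first by rewrite subr0 expr0 mul1r.
  rewrite addSn !uS opprD addrACA subrr add0r -TB (le_trans (Tb _)) // exprS -mulrA.
  by rewrite ler_wpM2l.
have small e : 0 < e -> exists N, rho ^+ N * C <= e.
  move=> e0; have d0 : 0 < e / (C + 1) by rewrite divr_gt0 //; lra.
  have h : (fun n => rho ^+ n) @ \oo --> (0 : R) by apply: cvg_expr; rewrite ger0_norm.
  have /cvgrPdist_le /(_ _ d0) [N _ hN] := h.
  exists N; have := hN N (leqnn N); rewrite sub0r normrN ger0_norm ?exprn_ge0 //.
  move=> /(ler_wpM2r C0) /le_trans; apply.
  by rewrite mulrAC ler_pdivrMr; nra.
have : cvg (u @ \oo).
  apply: cauchy_rnorm_cvg => e e0.
  have [N hN] := small (e / 2) ltac:(lra).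
  exists N => n k hn hk.
  rewrite -(subnKC hn) -(subnKC hk).
  rewrite -(subrKA (u N)) (le_trans (rnormD _ _)) //.
  rewrite [rnorm (u N - _)]rnormBC.
  have := ud N (n - N)%N; have := ud N (k - N)%N; lra.
move=> /cvg_rnormP hw; exists (lim (u @ \oo)).
set w := lim _ in hw *.
apply: subr0_eq; apply: rnorm_eq0; apply/eqP; rewrite eq_le rnorm_ge0 andbT.
apply/ler_addgt0Pr => e e0; rewrite add0r.
have [N hN] := hw (e / 2) ltac:(lra).
have -> : w - (a + T w) = (w - u N.+1) + T (u N - w).
  by rewrite uS TB !opprD -!addrA; do 2 congr (_ + _); rewrite addrA addNr add0r.
have := rnormD (w - u N.+1) (T (u N - w)).
have := Tb (u N - w); have := hN N (leqnn N); have := hN N.+1 (leqnSn N).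
rewrite (rnormBC w); have := rnorm_ge0 (u N - w); nra.
Qed.

End Neumann.

(** * Powers of a self-adjoint element of norm one *)

Section PowersOfSelfAdjoint.
Variables (R : realType) (A : cstarAlgType R) (h : A).
Hypotheses (hsa : h^star = h) (h1 : rnorm h = 1).

Let P j := pact h h 'X^j.

Lemma pow_mul i j : P i ** P j = P (i + j).+1.
Proof. by rewrite /P -pactMA -pactMX -exprSr -pactM -exprD addSn. Qed.

Lemma pow_adj j : (P j)^star = P j.
Proof.
elim: j => [|j ih]; first by rewrite /P expr0 pact1.
have P0 : P 0 = h by rewrite /P expr0 pact1.
have e : P j.+1 = P j ** P 0 by rewrite pow_mul addn0.
by rewrite {1}e cstar_adjM ih P0 hsa -{1}P0 pow_mul.
Qed.

Lemma pow_norm_le1 j : rnorm (P j) <= 1.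
Proof.
elim: j => [|j ih]; first by rewrite /P expr0 pact1 h1.
rewrite /P exprSr pactMX (le_trans (rnormM _ _)) // h1 mulr1; exact: ih.
Qed.

(** Log-convexity: |h^j|^2 = |h^(2j)| <= |h^(j-1)| |h^(j+1)|, so the norms
    cannot drop once two consecutive ones equal 1. *)
Lemma pow_norm1 j : rnorm (P j) = 1.
Proof.
suff : rnorm (P j) = 1 /\ rnorm (P j.+1) = 1 by case.
elim: j => [|j [i1 i2]].
  have e0 : P 0 = h by rewrite /P expr0 pact1.
  split; first by rewrite e0.
  by rewrite -[1%N]/(0 + 0).+1 -pow_mul -{1}pow_adj rnorm_adjM e0 h1 expr1n.
split => //; apply/eqP; rewrite eq_le pow_norm_le1 /=.
have : rnorm (P j.+1) ^+ 2 <= rnorm (P j) * rnorm (P j.+2).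
  by rewrite -rnorm_adjM pow_adj pow_mul addSnnS -pow_mul rnormM.
by rewrite i1 i2 expr1n mul1r.
Qed.

(** With Y = X^2 the positivity of 1 - (k+1) Y^k (1 - Y) propagates from k to
    k + 1 with the correction (1 - Y) (1 - Y^(k+1)).  This is the scalar bound
    (n+1) y^n (1 - y) <= 1 on [0, 1]. *)
Lemma bnd_pow_gap n : bnd h ('X^(n.*2) * (1 - 'X ^+ 2)) (n.+1%:R^-1).
Proof.
have hl : rnorm h <= 1 by rewrite h1.
pose Y : {poly R} := 'X ^+ 2.
have bY k : bnd h (Y ^+ k) 1.
  elim: k => [|k ih]; first by rewrite expr0; exact: bnd1.
  rewrite exprS; have := bndM (bndM (bndX hl) (bndX hl) ler01) ih ler01.
  by rewrite !mulr1 -expr2.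
have pY k : pos h (Y ^+ k) by rewrite /Y exprAC; apply: pos_sq.
have p1Y k : pos h (1 - Y ^+ k) by apply: pos_1B.
have C k : pos h (1 - k.+1%:R * (Y ^+ k * (1 - Y))).
  elim: k => [|k ih].
    have -> : 1 - 1%:R * (Y ^+ 0 * (1 - Y)) = Y ^+ 1 by ring.
    exact: pY.
  have -> : 1 - k.+2%:R * (Y ^+ k.+1 * (1 - Y)) =
     Y ^+ 1 * (1 - k.+1%:R * (Y ^+ k * (1 - Y))) + (1 - Y ^+ 1) * (1 - Y ^+ k.+1).
    by rewrite -(natr1 k.+1) exprS; ring.
  by apply: posD => //; apply: posM.
rewrite -mul2n exprM -/Y.
apply: pos_bnd; rewrite ?invr_ge0 //.
  by apply: posM => //; exact: (p1Y 1%N).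
have E : (n.+1%:R^-1)%:P * n.+1%:R = 1 :> {poly R}.
  by rewrite -[n.+1%:R in X in _ * X](rmorph_nat polyC) -polyCM mulVf ?pnatr_eq0.
have -> : (n.+1%:R^-1)%:P - Y ^+ n * (1 - Y) =
    n.+1%:R^-1 *: (1 - n.+1%:R * (Y ^+ n * (1 - Y))).
  by rewrite -mul_polyC [RHS]mulrBr mulr1; set Z := Y ^+ n * _; rewrite mulrA E mul1r.
by apply: pos_scale; rewrite ?invr_ge0.
Qed.

(** Multiply by g = h^(2n+1) on both sides and put g1 = g h^2.  Then
    g h g = g m g - g1 m g1 is of the order of |g - g1|, hence small, although
    g h g is a power of h and has norm 1. *)
Lemma no_resolvent m : m = h + h ** h ** m ** h ** h -> False.
Proof.
move=> em.
have hl : rnorm h <= 1 by rewrite h1.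
have m0 := rnorm_ge0 m.
have P0 : P 0 = h by rewrite /P expr0 pact1.
have [n hn] : exists n, 2 * rnorm m < n.+1%:R :> R.
  by exists (Num.truncn (2 * rnorm m)); rewrite truncnS_gt.
pose g := P n.*2; pose g' := P n.*2.+2.
have e1 : g ** h ** h = g' by rewrite -P0 /g !pow_mul !addn0.
have e2 : h ** h ** g = g' by rewrite -P0 /g !pow_mul !addSn !add0n.
have gap : rnorm (g - g') <= n.+1%:R^-1.
  have := bnd_pow_gap n h; rewrite h1 mulr1 mulrBr mulr1 pactB -exprD addn2.
  exact.
have key : g ** h ** g = (g - g') ** m ** g + g' ** m ** (g - g').
  rewrite !cmulBl cmulBr addrA subrK.
  have : g ** m ** g = g ** h ** g + g' ** m ** g'.
    rewrite {1}em cstar_mulDr cstar_mulDl; congr (_ + _).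
    by rewrite -{1}e1 -e2 !cstar_mulA.
  by move=> ->; rewrite addrK.
have n1 : rnorm (g ** h ** g) = 1 by rewrite -P0 /g !pow_mul pow_norm1.
have b1 : rnorm ((g - g') ** m ** g) <= n.+1%:R^-1 * rnorm m * 1.
  rewrite (le_trans (rnormM _ _)) // ler_pM ?rnorm_ge0 ?pow_norm_le1 //.
  by rewrite (le_trans (rnormM _ _)) // ler_wpM2r.
have b2 : rnorm (g' ** m ** (g - g')) <= 1 * rnorm m * n.+1%:R^-1.
  rewrite (le_trans (rnormM _ _)) // ler_pM ?rnorm_ge0 //.
  by rewrite (le_trans (rnormM _ _)) // ler_wpM2r ?pow_norm_le1.
have := rnormD ((g - g') ** m ** g) (g' ** m ** (g - g')).
rewrite -key n1 => /le_trans/(_ (lerD b1 b2)).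
rewrite mulr1 mul1r [_^-1 * _]mulrC -mulrDl.
rewrite -[rnorm m + rnorm m]/(rnorm m *+ 2) -[rnorm m *+ 2]mulr_natl.
by rewrite leNgt ltr_pdivrMr ?ltr0n // mul1r hn.
Qed.

End PowersOfSelfAdjoint.

(** * Triple homomorphisms are contractive *)

Section Contractive.
Variables (R : realType) (A B : cstarAlgType R) (S : {linear A -> B}).
Hypothesis hS : triple_homomorphism S.

(** The element w with w = a + Q^4 w for Q v = a v^star a exists when |a| < 1, and
    S carries the equation over because S(Q v) only involves triple products.
    The fourth power makes h occur squared on each side of m. *)
Lemma triple_contractive a : rnorm (S a) <= rnorm a.
Proof.
rewrite leNgt; apply/negP => lt_aS.
wlog S1 : a lt_aS / rnorm (S a) = 1.
  move=> H; have s0 : 0 < rnorm (S a) by apply: le_lt_trans lt_aS; exact: rnorm_ge0.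
  have s1 : rnorm (S ((rnorm (S a))^-1%:C *: a)) = 1.
    by rewrite linearZ /= rnormZr ger0_norm ?invr_ge0 ?(ltW s0) // mulVf // gt_eqF.
  apply: (H _ _ s1); rewrite s1 rnormZr ger0_norm ?invr_ge0 ?(ltW s0) //.
  by rewrite mulrC ltr_pdivrMr // mul1r.
rewrite S1 in lt_aS.
pose Q (v : A) := a ** v^star ** a.
have QB u v : Q (u - v) = Q u - Q v by rewrite /Q cadjB cmulBr cmulBl.
have a0 := rnorm_ge0 a.
have Qb v : rnorm (Q v) <= rnorm a ^+ 2 * rnorm v.
  rewrite /Q (le_trans (rnormM _ _)) // expr2 mulrAC ler_wpM2r //.
  by rewrite (le_trans (rnormM _ _)) // rnorm_adj.
pose T v := Q (Q (Q (Q v))).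
have Q1 v : rnorm (Q v) <= rnorm v.
  apply: (le_trans (Qb v)); rewrite -[leRHS]mul1r ler_wpM2r ?rnorm_ge0 //.
  by rewrite expr_le1 // ltW.
have [w ew] : exists w, w = a + T w.
  apply: (@neumann _ _ T (rnorm a ^+ 2)).
  - by move=> u v; rewrite /T !QB.
  - move=> v; apply: (le_trans (Qb _)); rewrite ler_wpM2l ?sqr_ge0 //.
    by rewrite (le_trans (Q1 _)) // (le_trans (Q1 _)) // Q1.
  - by rewrite sqr_ge0 expr_lt1.
have eS : S w = S a + S a ** (S a)^star ** S a ** (S a)^star ** S w **
   (S a)^star ** S a ** (S a)^star ** S a.
  rewrite {1}ew linearD /= /T /Q !(tripleQ hS).
  by rewrite !cstar_adjM !cstar_adjK !cstar_mulA.
pose y := S a; pose h := y^star ** y.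
have hsa : h^star = h by rewrite cstar_adjM cstar_adjK.
have h1 : rnorm h = 1 by rewrite rnorm_adjM S1 expr1n.
apply: (@no_resolvent _ _ h hsa h1 (y^star ** S w)).
by rewrite {1}eS cstar_mulDr /h /y !cstar_mulA.
Qed.

End Contractive.

(** * Tent functions *)

Section Hats.
Variable R : realType.
Implicit Types u v c d : R.

(** The tent of height 1 on [c - 1, c + 1], as a second difference of
    u |-> min u c; sums over consecutive integers c therefore telescope. *)
Definition hat u c : R := 2 * Num.min u c - Num.min u (c - 1) - Num.min u (c + 1).

Lemma hat_ge0 u c : 0 <= hat u c.
Proof.
by rewrite /hat /Order.min; case: ltP => ?; case: ltP => ?; case: ltP => ?; lra.
Qed.

Lemma hat_mul0 u c d : c + 2 <= d -> hat u c * hat u d = 0.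
Proof.
move=> cd; have [uc|uc] := leP u (c + 1).
  have -> : hat u d = 0; last by rewrite mulr0.
  by rewrite /hat /Order.min; case: ltP => ?; case: ltP => ?; case: ltP => ?; lra.
have -> : hat u c = 0; last by rewrite mul0r.
by rewrite /hat /Order.min; case: ltP => ?; case: ltP => ?; case: ltP => ?; lra.
Qed.

Lemma hat_mul0_nat u i j : (i + 2 <= j)%N || (j + 2 <= i)%N ->
  hat u i%:R * hat u j%:R = 0.
Proof.
by case/orP=> h; [|rewrite mulrC]; apply: hat_mul0; rewrite -natrD ler_nat.
Qed.

Lemma min_lip u v c : `|Num.min u c - Num.min v c| <= `|u - v|.
Proof.
rewrite /Order.min; case: ltP => uc; case: ltP => vc; rewrite ?subrr ?normr0 //.
  by rewrite !ler0_norm; lra.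
by rewrite !ger0_norm; lra.
Qed.

Lemma hat_lip u v c : `|hat u c - hat v c| <= 4 * `|u - v|.
Proof.
have := min_lip u v c; have := min_lip u v (c - 1); have := min_lip u v (c + 1).
rewrite /hat !ler_norml => /andP[? ?] /andP[? ?] /andP[? ?]; apply/andP; split; lra.
Qed.

Lemma hat_sum u m : \sum_(i < m) hat u i%:R =
  Num.min u 0 - Num.min u (-1) - (Num.min u m%:R - Num.min u (m%:R - 1)).
Proof.
elim: m => [|m ih]; first by rewrite big_ord0 sub0r; ring.
by rewrite big_ord_recr /= ih /hat -(natr1 m) addrK; ring.
Qed.

(** Summation by parts; on [0, m - 1] the right-hand side is u. *)
Lemma hat_moment u m : \sum_(i < m) i%:R * hat u i%:R =
  Num.min u (m%:R - 1) - Num.min u 0 -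
  (m%:R - 1) * (Num.min u m%:R - Num.min u (m%:R - 1)).
Proof.
elim: m => [|m ih]; first by rewrite big_ord0 sub0r; ring.
by rewrite big_ord_recr /= ih /hat -(natr1 m) addrK; ring.
Qed.

Lemma hat_sum_le1 u m : \sum_(i < m) hat u i%:R <= 1.
Proof.
rewrite hat_sum /Order.min.
by case: ltP => ?; case: ltP => ?; case: ltP => ?; case: ltP => ?; lra.
Qed.

End Hats.

(** * Cutting an element along the spectrum *)

Section LocalPieces.
Variables (R : realType) (A : cstarAlgType R) (x : A).
Hypotheses (xsa : x^star = x) (x1 : rnorm x <= 1).
Variable N : nat.
Implicit Types (f g : nat -> R) (a b : A).

(** Tents spaced by 1 / N; the N.+1 of them indexed by 0, ..., N add up to 1 on
    [0, 1]. *)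
Definition hatf i (t : R) : R := hat (N%:R * t) i%:R.

Lemma hatf_lip i : lipschitz1 (4 * N%:R : R) (hatf i).
Proof.
move=> s t; rewrite /hatf (le_trans (hat_lip _ _ _)) //.
by rewrite -mulrBr normrM ger0_norm // mulrA.
Qed.

Definition comb f m (t : R) : R := \sum_(i < m) f i * hatf i t.

Lemma comb_lip f m : exists L, lipschitz1 L (comb f m).
Proof.
elim: m => [|m [L hL]].
  by exists 0 => s t; rewrite /comb !big_ord0 subrr normr0 mul0r.
exists (L + `|f m| * (4 * N%:R)) => s t; rewrite /comb !big_ord_recr /=.
rewrite opprD addrACA (le_trans (ler_normD _ _)) // mulrDl lerD ?hL //.
by rewrite -mulrBr normrM -mulrA ler_wpM2l // hatf_lip.
Qed.

Definition piece i a := fcalc x (hatf i) a.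

Lemma fcalc_comb f m a :
  fcalc x (comb f m) a = \sum_(i < m) (f i)%:C *: piece i a.
Proof.
elim: m => [|m ih].
  rewrite big_ord0 -(scale0r a) -[0 : R[i]]/((0 : R)%:C) -(fcalc_const x).
  by apply: eq_fcalc => t _; rewrite /comb big_ord0.
have [L hL] := comb_lip f m.
rewrite big_ord_recr /= -ih /piece -(fcalcZ xsa x1 _ _ (@hatf_lip m)).
have hZ : lipschitz1 (`|f m| * (4 * N%:R)) (fun t => f m * hatf m t).
  by move=> s t; rewrite -mulrBr normrM -mulrA ler_wpM2l // hatf_lip.
rewrite -(fcalcD xsa x1 _ hL hZ).
by apply: eq_fcalc => t _; rewrite /comb big_ord_recr.
Qed.

(** Weights in [0, 1] keep the sum of tents between 0 and 1, so any selection of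
    pieces is bounded by the element itself, independently of N. *)
Lemma piece_bnd f m a : (forall i, 0 <= f i <= 1) ->
  rnorm (\sum_(i < m) (f i)%:C *: piece i a) <= rnorm a.
Proof.
move=> hf; rewrite -fcalc_comb; have [L hL] := comb_lip f m.
rewrite -[leRHS]mul1r; apply: (fcalc_bnd xsa x1 _ hL) => t.
have c0 i : 0 <= hatf i t by exact: hat_ge0.
rewrite ger0_norm /comb; last first.
  by apply: sumr_ge0 => i _; rewrite mulr_ge0 //; have /andP[] := hf i.
apply: le_trans (hat_sum_le1 (N%:R * t) m); apply: ler_sum => i _.
by rewrite ler_piMl //; have /andP[] := hf i.
Qed.

Lemma hat01 (t : R) : 0 <= t <= 1 -> 0 <= N%:R * t <= N%:R.
Proof.
by move=> /andP[t0 t1]; rewrite mulr_ge0 //= -[leRHS]mulr1 ler_wpM2l.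
Qed.

Lemma piece_sum a : \sum_(i < N.+1) piece i a = a.
Proof.
transitivity (fcalc x (comb (fun=> 1) N.+1) a).
  by rewrite fcalc_comb; apply: eq_bigr => i _; rewrite scale1r.
rewrite -[RHS]scale1r -[1 : R[i]]/((1 : R)%:C) -(fcalc_const x).
apply: eq_fcalc => t /hat01 /andP[h0 h1]; rewrite /comb.
transitivity (\sum_(i < N.+1) hat (N%:R * t) i%:R).
  by apply: eq_bigr => i _; rewrite mul1r.
rewrite hat_sum -natr1 addrK; move: (N%:R * t) (N%:R) h0 h1 => u M h0 h1.
by rewrite /Order.min; case: ltP => ?; case: ltP => ?; case: ltP => ?; case: ltP => ?; lra.
Qed.

Lemma piece_moment a :
  \sum_(i < N.+1) (i%:R)%:C *: piece i a = (N%:R)%:C *: pact x a (unit_var R).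
Proof.
rewrite -(fcalc_comb (fun i => i%:R)) -(fcalc_id x).
have idl : lipschitz1 (1 : R) id by move=> s t; rewrite mul1r.
rewrite -(fcalcZ xsa x1 _ _ idl).
apply: eq_fcalc => t /hat01 /andP[h0 h1]; rewrite /comb /hatf.
rewrite hat_moment -natr1 addrK; move: (N%:R * t) (N%:R) h0 h1 => u M h0 h1.
rewrite /Order.min; case: ltP => ?; case: ltP => ?; case: ltP => ?; nra.
Qed.

Lemma piece_ortho i j a b : (i + 2 <= j)%N || (j + 2 <= i)%N ->
  piece i a ** (piece j b)^star = 0.
Proof.
move=> h; apply: (fcalc_ortho xsa x1 _ _ (@hatf_lip i) (@hatf_lip j)) => t.
  rewrite ger0_norm ?hat_ge0 //.
  apply: le_trans (hat_sum_le1 (N%:R * t) i.+1).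
  by rewrite big_ord_recr /= lerDr sumr_ge0 // => k _; exact: hat_ge0.
exact: hat_mul0_nat.
Qed.

End LocalPieces.

(** * Preservation of zero products gives the balance identity *)

Definition residue (R : realType) (r i : nat) : R := (i %% 3 == r)%N%:R.

(** On the three diagonals |i - j| <= 1 the weight i - j is read off from the
    residues modulo 3; this separates the double sum into products of
    single sums. *)
Lemma residue_diff (R : realType) (i j : nat) :
  [|| i == j, i == j.+1 | j == i.+1] -> i%:R - j%:R =
  (residue R 1 i * residue R 0 j - residue R 0 i * residue R 1 j) +
  (residue R 2 i * residue R 1 j - residue R 1 i * residue R 2 j) +
  (residue R 0 i * residue R 2 j - residue R 2 i * residue R 0 j).
Proof.
have mS k : (k.+1 %% 3 = (k %% 3).+1 %% 3)%N by rewrite -addn1 -modnDml addn1.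
rewrite /residue; case/or3P=> /eqP->; first by ring.
  rewrite mS -natr1; have : (j %% 3 < 3)%N by rewrite ltn_mod.
  by case: (j %% 3)%N => [|[|[|]]] //= _; ring.
rewrite mS -natr1; have : (i %% 3 < 3)%N by rewrite ltn_mod.
by case: (i %% 3)%N => [|[|[|]]] //= _; ring.
Qed.

Section Balanced.
Variables (R : realType) (A B : cstarAlgType R) (S : {linear A -> B}).
Hypothesis hS : triple_homomorphism S.
Hypothesis hz : forall a b : A, a ** b^star = 0 -> S a ** (S b)^star = 0.

Section OneElement.
Variable x : A.
Hypotheses (xsa : x^star = x) (x1 : rnorm x <= 1).

Local Notation resc c := (pact x c (unit_var R)).

Let Psi N a b i j := S (piece x N i a) ** (S (piece x N j b))^star.

Lemma Psi_bilinear N a b (f g : nat -> R) :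
  S (\sum_(i < N.+1) (f i)%:C *: piece x N i a) **
    (S (\sum_(j < N.+1) (g j)%:C *: piece x N j b))^star =
  \sum_(i < N.+1) \sum_(j < N.+1) (f i * g j)%:C *: Psi N a b i j.
Proof.
rewrite !linear_sum cadj_sum cmul_suml; apply: eq_bigr => i _.
rewrite cmul_sumr; apply: eq_bigr => j _.
rewrite !linearZ /= cstar_adjZ cstar_mulZl cstar_mulZr scalerA rmorphM.
by congr (_ * _ *: _); exact: conjc_real.
Qed.

(** Off the three central diagonals the pieces have zero product, and there S
    vanishes by hypothesis.  On the diagonals [residue_diff] applies, and each
    resulting product is bounded by contractivity and [piece_bnd]. *)
Lemma balance_estimate N a b :
  rnorm (S (resc a) ** (S b)^star - S a ** (S (resc b))^star)
    * N%:R <= 6 * (rnorm a * rnorm b).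
Proof.
pose W (f : nat -> R) (c : A) : A := \sum_(i < N.+1) (f i)%:C *: piece x N i c.
have W1 c : c = W (fun=> 1) c.
  by rewrite -[LHS](piece_sum xsa x1 N); apply: eq_bigr => i _; rewrite scale1r.
have WN c : (N%:R)%:C *: resc c = W (fun i => i%:R) c.
  by rewrite -(piece_moment xsa x1).
have Wb f c : (forall i, 0 <= f i <= 1) -> rnorm (W f c) <= rnorm c.
  by move=> hf; exact: (piece_bnd xsa x1).
pose V f g := S (W f a) ** (S (W g b))^star.
have res01 r i : 0 <= residue R r i <= 1.
  by rewrite /residue; case: (_ == _); rewrite /= ?lexx ler01.
have Vb r s : rnorm (V (residue R r) (residue R s)) <= rnorm a * rnorm b.
  rewrite (le_trans (rnormM _ _)) // rnorm_adj ler_pM ?rnorm_ge0 //;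
    exact: le_trans (triple_contractive hS _) (Wb _ _ (res01 _)).
have E : (N%:R)%:C *: (S (resc a) ** (S b)^star -
                      S a ** (S (resc b))^star) =
  (V (residue R 1) (residue R 0) - V (residue R 0) (residue R 1)) +
  (V (residue R 2) (residue R 1) - V (residue R 1) (residue R 2)) +
  (V (residue R 0) (residue R 2) - V (residue R 2) (residue R 0)).
  rewrite scalerBr -cstar_mulZl -linearZ /= WN.
  have -> : (N%:R)%:C *: (S a ** (S (resc b))^star) =
            S a ** (S (W (fun i => i%:R) b))^star.
    rewrite -WN linearZ /= cstar_adjZ cstar_mulZr; congr (_ *: _).
    exact: esym (conjc_real _).
  rewrite {1}(W1 b) {2}(W1 a) -/(V _ _) -/(V _ _) /V !Psi_bilinear.
  rewrite -!sumrB -!big_split /=; apply: eq_bigr => i _.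
  rewrite -!sumrB -!big_split /=; apply: eq_bigr => j _.
  rewrite -!scalerBl -!scalerDl.
  have [far|near] := boolP ((i + 2 <= j)%N || (j + 2 <= i)%N).
    by rewrite /Psi hz ?scaler0 // piece_ortho.
  congr (_ *: _); rewrite -!rmorphB -!rmorphD; congr (_%:C).
  by rewrite mulr1 mul1r; apply: residue_diff; lia.
have -> : rnorm (S (resc a) ** (S b)^star - S a ** (S (resc b))^star)
    * N%:R = rnorm ((N%:R)%:C *: (S (resc a) ** (S b)^star -
                      S a ** (S (resc b))^star)).
  by rewrite rnormZr ger0_norm // mulrC.
rewrite E.
have P r s :
    rnorm (V (residue R r) (residue R s) - V (residue R s) (residue R r)) <=
    2 * (rnorm a * rnorm b).
  by rewrite (le_trans (rnormB _ _)) // mulr_natl mulr2n lerD.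
rewrite (le_trans (rnormD _ _)) //.
have := rnormD (V (residue R 1) (residue R 0) - V (residue R 0) (residue R 1))
  (V (residue R 2) (residue R 1) - V (residue R 1) (residue R 2)).
have := P 1%N 0%N; have := P 2%N 1%N; have := P 0%N 2%N; lra.
Qed.

Lemma balanced_unit_var a b :
  S (resc a) ** (S b)^star = S a ** (S (resc b))^star.
Proof.
apply: subr0_eq; apply: rnorm_eq0; apply/eqP; rewrite eq_le rnorm_ge0 andbT.
set d := rnorm _; rewrite leNgt; apply/negP => d0.
have : 6 * (rnorm a * rnorm b) / d < (Num.truncn (6 * (rnorm a * rnorm b) / d)).+1%:R.
  by rewrite truncnS_gt.
rewrite ltr_pdivrMr // [_%:R * d]mulrC ltNge => /negP; apply.
exact: balance_estimate.
Qed.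

Lemma balanced_selfadj_le1 a b : S (a ** x) ** (S b)^star = S a ** (S (b ** x))^star.
Proof.
have E c : resc c = (2^-1)%:C *: (c + c ** x).
  by rewrite /unit_var pactZ pactD pact1 pactX.
have cJ : Num.conj ((2^-1 : R)%:C) = (2^-1 : R)%:C := conjc_real _.
have n0 : (2^-1 : R)%:C != 0 by rewrite eq_complex /= eqxx andbT invr_eq0 pnatr_eq0.
have := balanced_unit_var a b; rewrite !E !scalerDr !linearD !linearZ /=.
rewrite cstar_adjD !cstar_adjZ cJ cstar_mulDl cstar_mulDr.
by rewrite !cstar_mulZl !cstar_mulZr => /addrI/(scalerI n0).
Qed.

End OneElement.

Lemma balanced_selfadj f a b : f^star = f ->
  S (a ** f) ** (S b)^star = S a ** (S (b ** f))^star.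
Proof.
move=> fsa; pose c := (rnorm f + 1)^-1.
have c0 : 0 < c by rewrite invr_gt0 ltr_wpDl ?rnorm_ge0.
have cJ : Num.conj c%:C = c%:C := conjc_real c.
have xsa : (c%:C *: f)^star = c%:C *: f by rewrite cstar_adjZ cJ fsa.
have x1 : rnorm (c%:C *: f) <= 1.
  by rewrite rnormZr gtr0_norm // mulrC ler_pdivrMr ?mul1r ?lerDl // ltr_wpDl ?rnorm_ge0.
have := balanced_selfadj_le1 xsa x1 a b.
rewrite !cstar_mulZr !linearZ /= cstar_adjZ cJ cstar_mulZl cstar_mulZr.
by apply: scalerI; rewrite eq_complex /= eqxx andbT gt_eqF.
Qed.

(** Both sides are linear in f, so f splits into its self-adjoint parts. *)
Lemma zero_products_balanced f a b :
  S (a ** f) ** (S b)^star = S a ** (S (b ** f^star))^star.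
Proof.
have hJ : Num.conj (2^-1 : R)%:C = (2^-1 : R)%:C := conjc_real _.
have iJ : Num.conj ('i : R[i]) = - 'i.
  by apply/eqP; rewrite eq_complex /= oppr0 !eqxx.
have niJ : Num.conj (- 'i : R[i]) = 'i.
  by apply/eqP; rewrite eq_complex /= oppr0 opprK !eqxx.
pose p := (2^-1 : R)%:C *: (f + f^star).
pose q := (2^-1 : R)%:C *: ('i *: (f^star - f)).
have psa : p^star = p.
  by rewrite /p cstar_adjZ hJ cstar_adjD cstar_adjK addrC.
have qsa : q^star = q.
  rewrite /q !cstar_adjZ hJ iJ cadjB cstar_adjK scaleNr -scalerN opprB //.
have fE : f = p + 'i *: q.
  have ii : ('i : R[i]) * 'i = -1 by rewrite -expr2 sqr_i.
  have -> : 'i *: q = (2^-1 : R)%:C *: (f - f^star).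
    by rewrite /q !scalerA mulrAC ii mulN1r scaleNr -scalerN opprB.
  have two (u : A) : u + u = (2 : R[i]) *: u by rewrite scaler_nat mulr2n.
  rewrite /p -scalerDr addrACA subrr addr0 two scalerA.
  suff -> : (2^-1 : R)%:C * 2 = 1 :> R[i] by rewrite scale1r.
  by rewrite -[2 : R[i]](rmorph_nat (real_complex R)) -rmorphM mulVf // pnatr_eq0.
clearbody p q.
rewrite {1}fE cstar_mulDr linearD cstar_mulZr linearZ /= cstar_mulDl cstar_mulZl.
rewrite (balanced_selfadj a b psa) (balanced_selfadj a b qsa).
rewrite [in RHS]fE cstar_adjD cstar_adjZ psa qsa iJ.
rewrite cstar_mulDr linearD cstar_mulZr linearZ /= cstar_adjD cstar_adjZ.
by rewrite niJ cstar_mulDr cstar_mulZr.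
Qed.

End Balanced.

Theorem proposition4 (R : realType) (A B : cstarAlgType R)
    (S : {linear A -> B}) (hS : triple_homomorphism S) :
  [<-> tro_homomorphism S;
       preserves_tro_zero_products S;
       forall a b : A, a ** b^star = 0 -> S a ** (S b)^star = 0].
Proof.
tfae.
- by move=> htro a b c abc0; rewrite -htro abc0 linear0.
- move=> hz a b ab0; apply: mul_adj_eq0.
  rewrite cstar_adjM cstar_adjK cstar_mulA.
  by rewrite (hz a b b) ?cmul0l // ab0 cmul0l.
- move=> hz; apply: balanced_tro => // a b f.
  exact: zero_products_balanced.
Qed.
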